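(* Let $d\ge 2$ and let $p_{n}\in\mathcal{P}_{n}$, $n\geq 3$, be a sequence bounded in $L^{\infty}(\mathbb{S}_1,\mathbb{R}^d)$ with $\mathcal{E}_{n}(p_{n})=\inf_{\mathcal{P}_{n}}\mathcal{E}_{n}$ for every $n$. Then there is a subsequence with $p_{n_{k}}\to\gamma$ in $W^{1,\infty}(\mathbb{S}_{1},\mathbb{R}^{d})$, where $\gamma$ is a round circle of length $1$ (parametrised by arc length).
   Context: $\mathbb{S}_{1}$ is the circle of length $1$ and $d(\cdot,\cdot)$ its intrinsic (shortest arc) metric. $\mathcal{P}_{n}$ is the set of closed equilateral polygons with $n$ segments and total length $1$ in $\mathbb{R}^{d}$, parametrised by arc length, i.e. closed curves $p:\mathbb{S}_{1}\to\mathbb{R}^{d}$ with $|p'|=1$ a.e. for which there are consecutive points $a_{1},\dots,a_{n}$ on $\mathbb{S}_{1}$ (indices mod $n$) with $d(a_{i+1},a_{i})=1/n$ such that $p$ is affine on each arc $[a_{i},a_{i+1}]$. The discrete Möbius energy of $p\in\mathcal{P}_{n}$ is $$\mathcal{E}_{n}(p)=\sum_{\substack{i,j=1\\ i\neq j}}^{n}\Big(\frac{1}{|p(a_{j})-p(a_{i})|^{2}}-\frac{1}{d(a_{j},a_{i})^{2}}\Big)d(a_{i+1},a_{i})\,d(a_{j+1},a_{j})\in[0,\infty],$$ where $1/0=+\infty$. $W^{1,\infty}(\mathbb{S}_{1},\mathbb{R}^{d})$ is the usual Sobolev space of closed curves. A round circle of length $1$ is a circle of radius $1/(2\pi)$ in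 some affine $2$-plane of $\mathbb{R}^{d}$, traversed once. *)

(* Defs.v *)
(* MathComp / MathComp-Analysis. *)
From HB Require Import structures.
From mathcomp Require Import all_boot all_order all_algebra.
From mathcomp Require Import all_classical all_reals all_analysis.
Set Implicit Arguments.
Unset Strict Implicit.
Unset Printing Implicit Defensive.
Import Order.TTheory GRing.Theory Num.Theory.
Import numFieldNormedType.Exports.
Local Open Scope classical_set_scope.
Local Open Scope ring_scope.

(* The circle of length 1 is R/Z: its points are given by real representatives
   and the maps defined on it are the 1-periodic maps on R.  For such maps,
   "almost everywhere" and essential suprema with respect to the Lebesgue
   measure of R agree with those over one period. *)

Section Euclidean.
Variables (R : realType) (d : nat).
Implicit Types u v : 'rV[R]_d.

(* The library norm of 'rV[R]_d is the max norm, hence this one. *)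
Definition dotp u v : R := \sum_(i < d) u 0 i * v 0 i.

Definition enorm v : R := Num.sqrt (dotp v v).

End Euclidean.

(* Intrinsic distance of R/Z. *)
Definition cdist (R : realType) (s t : R) : R :=
  inf [set `|s - t + k%:~R| | k in [set: int]].

Section Polygons.
Variables (R : realType) (d : nat).
Implicit Types (p : R -> 'rV[R]_d) (a : nat -> R) (n : nat).

(* Consecutive points of the circle, with indices mod n, are lifted to an
   increasing sequence of reals that advances by one full turn in n steps. *)
Definition vertices n p a : Prop :=
  [/\ forall i, a i < a i.+1,
      forall i, a (i + n)%N = a i + 1,
      forall i, cdist (a i.+1) (a i) = n%:R^-1
    & forall i, exists v w : 'rV[R]_d,
        forall t, a i <= t <= a i.+1 -> p t = v + t *: w].

(* Continuity of p follows from affinity on the closed arcs. *)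
Definition equilateral_polygons n : set (R -> 'rV[R]_d) :=
  [set p : R -> 'rV[R]_d | [/\ periodic p 1,
    {ae lebesgue_measure,
       forall t : R, derivable p t 1 /\ enorm (derive1 p t) = 1}
  & exists a, vertices n p a]].

(* Extended reals: the inverse of 0%:E is +oo. *)
Definition mobius_energy_at n p a : \bar R :=
  (\sum_(i < n) \sum_(j < n | j != i)
     (((enorm (p (a j) - p (a i)) ^+ 2)%:E)^-1
       - ((cdist (a j) (a i) ^+ 2)^-1)%:E)
     * (cdist (a i.+1) (a i) * cdist (a j.+1) (a j))%:E)%E.

(* For a polygon with n >= 3 segments, the vertices are unique up to a shift of
   the indices: p being closed with unit speed, at least one vertex is a genuine
   corner, and it determines all the others, spaced by 1/n.  The sum above is
   invariant under such a shift. *)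
Definition mobius_energy n p : \bar R :=
  mobius_energy_at n p (get [set a | vertices n p a]).

(* Arc-length parametrization, traversed once over a period, of the circle of
   center c and radius 1 / (2 pi) in the plane c + span(u, v); changing (u, v)
   changes the starting point and the orientation. *)
Definition round_circle (g : R -> 'rV[R]_d) : Prop :=
  exists c u v : 'rV[R]_d,
    [/\ dotp u u = 1, dotp v v = 1, dotp u v = 0
      & forall t, g t = c + (2 * pi)^-1 *: (cos (2 * pi * t) *: u
                                            + sin (2 * pi * t) *: v)].

End Polygons.

Section Sobolev.
Variables (R : realType) (d : nat).
Implicit Types f g : R -> 'rV[R]_d.

Definition Linfty_norm f : \bar R :=
  Lnorm lebesgue_measure +oo%E (fun t : R => (enorm (f t))%:E).

Definition Linfty f : Prop :=
  [/\ periodic f 1,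
      forall i, measurable_fun [set: R] (fun t => f t 0 i)
    & (Linfty_norm f < +oo)%E].

Definition circle_test (phi : R -> R) : Prop :=
  periodic phi 1 /\ forall k t, derivable (derive1n k phi) t 1.

(* f is in W^{1,oo} of the circle, with weak derivative g; such a g is unique up
   to almost everywhere equality. *)
Definition W1infty_derivative f g : Prop :=
  [/\ Linfty f, Linfty g
    & forall phi, circle_test phi -> forall i,
        \int[lebesgue_measure]_(t in `[0, 1]) (f t 0 i * derive1 phi t)
        = - \int[lebesgue_measure]_(t in `[0, 1]) (g t 0 i * phi t)].

Definition cvg_W1infty (u : nat -> R -> 'rV[R]_d) f : Prop :=
  exists (du : nat -> R -> 'rV[R]_d) (df : R -> 'rV[R]_d),
    [/\ forall k, W1infty_derivative (u k) (du k),
        W1infty_derivative f df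
      & (fun k => Linfty_norm (fun t => (u k t - f t)%R)
                  + Linfty_norm (fun t => (du k t - df t)%R))%E @ \oo --> 0%E].

End Sobolev.

(* Main.v *)
Require Import Defs.
From HB Require Import structures.
From mathcomp Require Import all_boot all_order all_algebra.
From mathcomp Require Import all_classical all_reals all_analysis.
From mathcomp Require Import ess_sup_inf measurable_realfun ring lra zify.
Set Implicit Arguments.
Unset Strict Implicit.
Unset Printing Implicit Defensive.
Import Order.TTheory GRing.Theory Num.Theory.
Import numFieldNormedType.Exports.
Local Open Scope classical_set_scope.
Local Open Scope ring_scope.

(** Let [x_0, ..., x_(n-1)] be the vertices of an equilateral [n]-gon.  Expanding
    them in discrete Fourier modes, the mean of [|x_(i+k) - x_i|^2] over [i] is, for
    every [k], at most its value for the regular [n]-gon.  As [1 / D] decreases and is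
    strictly convex, the energy is at least that of the regular [n]-gon, with equality only
    if all the distances [|x_j - x_i|] are those of the regular [n]-gon, that is, if
    the polygon is congruent to it.  So the minimizers are determined by a center, two
    orthonormal vectors and a phase, which converge along a subsequence; the regular
    [n]-gons converge uniformly to the round circle, together with their
    velocities. *)

(** * Fourier analysis of closed polygons *)

(** The bound on the means is proved mode by mode. For the shift [k], the mode [m] enters with the
    factor [4 sin^2 (k m pi / n)], and its share of the prescribed edge lengths is the case [k = 1].
    What matters is thus the ratio [sin^2 (k m pi / n) / sin^2 (m pi / n)], and it is largest at
    [m = 1] because [sin (k x) / sin x] decreases in [x] as long as [k x <= pi / 2]. The regular
    polygon is carried by the extremal modes [1] and [n - 1] alone, so it attains the bound for all
    shifts [k] at once.

    The subtracted terms [1 / d^2] of the energy are the same for all equilateral polygons with [n]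
    segments, so only the sum of the inverse squared distances is compared.

    The velocities of polygons jump at the corners, so their uniform convergence is read off from
    the explicit form of the minimizers. The bound in [L^oo] serves to keep their centers in a
    bounded set. *)

(** Division-free form of the monotonicity of [sin (k x) / sin x]. In the induction, the addition
    formula splits [sin ((k + 1) x) sin a] into two terms. The first is bounded by the induction
    hypothesis and [cos x <= cos a], the second by [cos (k x) <= cos (k a)]. *)
Lemma sin_mulrn_ratio (R : realType) (a x : R) (k : nat) :
  0 <= a -> a <= x -> x <= pi / 2 -> k%:R * x <= pi / 2 ->
  sin (k%:R * x) * sin a <= sin (k%:R * a) * sin x.
Proof.
move=> a0 ax xpi; have pi0 := @pi_gt0 R.
have sx : 0 <= sin x by apply: sin_ge0_pi; apply/andP; split; lra.
have sa : 0 <= sin a by apply: sin_ge0_pi; apply/andP; split; lra.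
have cosle y z : 0 <= y -> y <= z -> z <= pi / 2 -> cos z <= cos y :> R.
  move=> y0 yz zpi; rewrite leNgt ltr_cos ?in_itv/= -?leNgt //;
  by apply/andP; split; lra.
elim: k => [|k IH] kx; first by rewrite !mul0r sin0 !mul0r.
move: kx; rewrite -natr1 mulrDl mul1r => kx.
have k0 : 0 <= k%:R :> R by [].
have kax : k%:R * a <= k%:R * x by rewrite ler_wpM2l.
have ka0 : 0 <= k%:R * a by rewrite mulr_ge0.
have {}IH := IH ltac:(lra).
have ca : 0 <= cos a by apply: cos_ge0_pihalf; apply/andP; split; lra.
have cx : cos x <= cos a by apply: cosle => //; lra.
have ckx : cos (k%:R * x) <= cos (k%:R * a) by apply: cosle => //; lra.
have sk : 0 <= sin (k%:R * x) by apply: sin_ge0_pi; apply/andP; split; lra.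
rewrite !mulrDl !mul1r !sinD.
have h1 : sin (k%:R * x) * sin a * cos x <= sin (k%:R * a) * sin x * cos a.
  apply: (@le_trans _ _ (sin (k%:R * x) * sin a * cos a)).
    by rewrite ler_wpM2l// mulr_ge0.
  by rewrite ler_wpM2r.
have h2 : cos (k%:R * x) * (sin x * sin a) <= cos (k%:R * a) * (sin x * sin a).
  by rewrite ler_wpM2r// mulr_ge0.
lra.
Qed.

(* For [k x > pi / 2], the bound follows from the case [k x = pi / 2]. *)
Lemma sin_mulrn_ratio_norm (R : realType) (a x : R) (k : nat) : (0 < k)%N ->
  0 <= a -> a <= x -> x <= pi / 2 -> k%:R * a <= pi / 2 ->
  `|sin (k%:R * x)| * sin a <= sin (k%:R * a) * sin x.
Proof.
move=> k0 a0 ax xpi kapi; have pi0 := @pi_gt0 R.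
have k0R : 0 < k%:R :> R by rewrite ltr0n.
have sa : 0 <= sin a by apply: sin_ge0_pi; apply/andP; split; lra.
have [kx|kx] := leP (k%:R * x) (pi / 2).
  rewrite ger0_norm; first exact: sin_mulrn_ratio.
  by apply: sin_ge0_pi; apply/andP; split; [apply: mulr_ge0; lra | lra].
pose x0 : R := pi / 2 / k%:R.
have kx0 : k%:R * x0 = pi / 2 by rewrite /x0 mulrC divfK// gt_eqF.
have ax0 : a <= x0 by rewrite -(ler_pM2l k0R) kx0.
have x0x : x0 <= x by rewrite -(ler_pM2l k0R) kx0 ltW.
have := @sin_mulrn_ratio R a x0 k a0 ax0 ltac:(lra) ltac:(by rewrite kx0).
rewrite kx0 sin_pihalf mul1r => h.
apply: (@le_trans _ _ (sin a)); first by rewrite ler_piMl// sin_max.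
apply: (le_trans h); rewrite ler_wpM2l//.
  by apply: sin_ge0_pi; apply/andP; split; [apply: mulr_ge0; lra | lra].
by rewrite leNgt ltr_sin ?in_itv/= -?leNgt //; apply/andP; split; lra.
Qed.

Lemma sqr_sin_npiB (R : realType) (n : nat) (x : R) :
  sin (n%:R * pi - x) ^+ 2 = sin x ^+ 2.
Proof.
elim: n => [|n IH]; first by rewrite mul0r sub0r sinN sqrrN.
by rewrite -natr1 mulrDl mul1r addrAC sinDpi sqrrN.
Qed.

(** The squares are unchanged under [k -> n - k] and under [m -> n - m], so both indices may be
    taken at most [n / 2]. Then [sin_mulrn_ratio_norm] applies with [a = pi / n] and
    [x = m pi / n]. *)
Lemma sqr_sin_ratio (R : realType) (n k m : nat) :
  (0 < k < n)%N -> (0 < m < n)%N ->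
  sin (k%:R * (m%:R * (pi / n%:R))) ^+ 2 * sin (pi / n%:R) ^+ 2
  <= sin (k%:R * (pi / n%:R)) ^+ 2 * sin (m%:R * (pi / n%:R)) ^+ 2 :> R.
Proof.
have pi0 := @pi_gt0 R.
wlog : k / (k.*2 <= n)%N => [hw|hk2].
  have [h|h] := leqP k.*2 n; first exact: hw.
  move=> hk hm; have := hw (n - k)%N ltac:(lia) ltac:(lia) hm.
  rewrite natrB; last lia.
  have n0 : n%:R != 0 :> R by rewrite pnatr_eq0; lia.
  have -> : (n%:R - k%:R) * (pi / n%:R) = 1%:R * pi - k%:R * (pi / n%:R) :> R.
    by rewrite mul1r mulrBl mulrCA divff// mulr1.
  have -> : (n%:R - k%:R) * (m%:R * (pi / n%:R))
    = m%:R * pi - k%:R * (m%:R * (pi / n%:R)) :> R by field.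
  by rewrite !sqr_sin_npiB.
wlog : m / (m.*2 <= n)%N => [hw|hm2].
  have [h|h] := leqP m.*2 n; first exact: hw.
  move=> hk hm; have := hw (n - m)%N ltac:(lia) hk ltac:(lia).
  rewrite natrB; last lia.
  have n0 : n%:R != 0 :> R by rewrite pnatr_eq0; lia.
  have -> : (n%:R - m%:R) * (pi / n%:R) = 1%:R * pi - m%:R * (pi / n%:R) :> R.
    by field.
  have -> : k%:R * (1%:R * pi - m%:R * (pi / n%:R))
    = k%:R * pi - k%:R * (m%:R * (pi / n%:R)) :> R by field.
  by rewrite !sqr_sin_npiB.
move=> /andP[k0 kn] /andP[m0 mn].
have n0 : 0 < n%:R :> R by rewrite ltr0n; lia.
have half j : (j.*2 <= n)%N -> j%:R * (pi / n%:R) <= pi / 2 :> R.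
  move=> hj; rewrite mulrCA; apply: ler_wpM2l; first exact: ltW.
  rewrite ler_pdivrMr// mulrC ler_pdivlMr// -natrM ler_nat; lia.
have a0 : 0 <= pi / n%:R :> R by rewrite divr_ge0 ?ltW.
have am : pi / n%:R <= m%:R * (pi / n%:R) :> R.
  by rewrite ler_peMl// ler1n.
have := sin_mulrn_ratio_norm k0 a0 am (half _ hm2) (half _ hk2) => h.
rewrite -!exprMn -[X in X <= _]real_normK ?num_real//.
rewrite lerXn2r ?nnegrE// ?normr_ge0//.
  apply: le_trans h; apply: mulr_ge0 => //.
  by apply: sin_ge0_pi; apply/andP; split => //; have := half 1%N ltac:(lia); lra.
apply: le_trans h; rewrite normrM ler_wpM2l// ger0_norm//.
by apply: sin_ge0_pi; apply/andP; split => //; have := half 1%N ltac:(lia); lra.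
Qed.

Lemma sqr_sin_npiD (R : realType) (n : nat) (x : R) :
  sin (n%:R * pi + x) ^+ 2 = sin x ^+ 2.
Proof. by rewrite -[x in LHS]opprK sqr_sin_npiB sinN sqrrN. Qed.

Lemma sin2npiB (R : realType) (n : nat) (x : R) :
  sin (n%:R * (2 * pi) - x) = - sin x.
Proof.
elim: n => [|n IH]; first by rewrite mul0r sub0r sinN.
rewrite -natr1 (_ : _ - x = n%:R * (2 * pi) - x + pi *+ 2) ?sinD2pi//.
by rewrite -mulr_natr; ring.
Qed.

Lemma cos_2npi (R : realType) (n : nat) : cos (n%:R * (2 * pi)) = 1 :> R.
Proof.
elim: n => [|n IH]; first by rewrite mul0r cos0.
rewrite -natr1 (_ : _ * _ = n%:R * (2 * pi) + pi *+ 2) ?cosD2pi//.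
by rewrite -mulr_natr; ring.
Qed.

Lemma sin_pi_frac_eq0 (R : realType) (n c : nat) : (0 < n)%N ->
  (sin (c%:R * (pi / n%:R)) == 0 :> R) = (n %| c)%N.
Proof.
move=> n0; have n0R : n%:R != 0 :> R by rewrite pnatr_eq0 -lt0n.
rewrite -sqrf_eq0 {1}(divn_eq c n) natrD natrM.
rewrite (_ : _ * (pi / _) =
  (c %/ n)%:R * pi + (c %% n)%:R * (pi / n%:R)); last by field.
rewrite sqr_sin_npiD sqrf_eq0 /dvdn.
have [->|r0] := eqVneq (c %% n)%N 0%N; first by rewrite mul0r sin0 eqxx.
apply/negbTE; rewrite gt_eqF//; apply: sin_gt0_pi.
have pi0 := @pi_gt0 R.
rewrite mulr_gt0 ?divr_gt0 ?ltr0n ?lt0n//=.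
rewrite mulrCA gtr_pMr// ltr_pdivrMr ?ltr0n// mul1r ltr_nat.
by rewrite ltn_pmod.
by rewrite -lt0n.
Qed.

(** Each product [2 sin x cos (2 m x)] is [sin ((2 m + 1) x) - sin ((2 m - 1) x)]. *)
Lemma telescope_cos_sum (R : realType) (n : nat) (x : R) :
  sin x * (\sum_(m < n) cos (m%:R * (2 * x))) *+ 2
  = sin (n%:R * (2 * x) - x) + sin x.
Proof.
elim: n => [|n IH].
  by rewrite big_ord0 mulr0 mul0rn mul0r sub0r sinN addNr.
rewrite big_ord_recr/= mulrDr mulrnDl {}IH.
rewrite (_ : n.+1%:R * _ - x = n%:R * (2 * x) + x); last first.
  by rewrite -natr1; ring.
by rewrite sinB sinD -mulr_natr; ring.
Qed.

(** At [x = c pi / n] the telescoped sum is [sin (2 pi c - x) + sin x = 0], and [sin x] vanishes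
    only if [n] divides [c]. *)
Lemma sum_cos_nat (R : realType) (n c : nat) : (0 < n)%N ->
  \sum_(m < n) cos (m%:R * (2 * (c%:R * (pi / n%:R))))
  = if (n %| c)%N then n%:R else 0 :> R.
Proof.
move=> n0; have n0R : n%:R != 0 :> R by rewrite pnatr_eq0 -lt0n.
case: ifP => [/dvdnP[q ->]|ndvd].
  rewrite (eq_bigr (fun=> 1)) => [|m _]; first by rewrite big_const_ord iter_addr_0.
  apply: etrans (@cos_2npi R (m * q)); congr cos; rewrite !natrM; by field.
have sn0 : sin (c%:R * (pi / n%:R)) != 0 :> R by rewrite sin_pi_frac_eq0 ?ndvd.
have := telescope_cos_sum n (c%:R * (pi / n%:R) : R).
rewrite (_ : n%:R * _ = c%:R * (2 * pi)); last by field.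
rewrite sin2npiB addNr => /eqP.
by rewrite -mulr_natr !mulf_eq0 (negbTE sn0) pnatr_eq0 orbF/= => /eqP.
Qed.

Lemma sum_cosB (R : realType) (n a b : nat) : (0 < n)%N ->
  \sum_(m < n) cos (m%:R * (2 * ((a%:R - b%:R) * (pi / n%:R))))
  = if (a == b %[mod n])%N then n%:R else 0 :> R.
Proof.
move=> n0; wlog ba : a b / (b <= a)%N => [hw|].
  have /orP[h|h] := leq_total b a; first exact: hw.
  rewrite eq_sym -hw//; apply: eq_bigr => m _.
  by rewrite -cosN; congr cos; ring.
by rewrite -natrB// sum_cos_nat// eqn_mod_dvd.
Qed.

(** Parseval's identity for the difference of [f] and its cyclic shift by [k] (the addition of
    ['I_N.+1] is modulo [N.+1]). Shifting multiplies the mode [m] by a phase of angle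
    [2 k m pi / N.+1], and the squared modulus of that phase minus 1 is
    [4 sin^2 (k m pi / N.+1)]. *)
Lemma sum_sqr_diff_fourier (R : realType) (N : nat) (f : 'I_N.+1 -> R)
    (k : 'I_N.+1) :
  N.+1%:R * \sum_i (f (i + k) - f i) ^+ 2
  = \sum_(m < N.+1) (((\sum_j f j * cos (m%:R * (2 * (j%:R * (pi / N.+1%:R))))) ^+ 2
       + (\sum_j f j * sin (m%:R * (2 * (j%:R * (pi / N.+1%:R))))) ^+ 2)
       * (4 * sin (k%:R * (m%:R * (pi / N.+1%:R))) ^+ 2)).
Proof.
set h := pi / N.+1%:R.
have eqm (a b : 'I_N.+1) : (a == b %[mod N.+1])%N = (a == b).
  by rewrite !modn_small.
have addm (a b : 'I_N.+1) : nat_of_ord (a + b) = ((a + b) %% N.+1)%N by [].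
pose e (a b : nat) : R := \sum_(m < N.+1) cos (m%:R * (2 * ((a%:R - b%:R) * h))).
have eE a b : e a b = if (a == b %[mod N.+1])%N then N.+1%:R else 0 by exact: sum_cosB.
(* Since [e a b] is [N.+1] times the indicator of [a = b] modulo [N.+1], this quadratic form
   collapses to the left-hand side. *)
transitivity (\sum_j \sum_l f j * f l *
    (e j l *+ 2 - e (j + k)%N l - e j (l + k)%N)).
  have -> : \sum_i (f (i + k) - f i) ^+ 2
    = \sum_i (f i ^+ 2 *+ 2 - f i * f (i + k) *+ 2).
    have hs : \sum_i f (i + k) ^+ 2 = \sum_i f i ^+ 2.
      by rewrite [RHS](reindex_inj (addIr k)).
    rewrite (eq_bigr (fun i => f (i + k) ^+ 2 + (f i ^+ 2 - f i * f (i + k) *+ 2))).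
      rewrite big_split/= hs -big_split/=; apply: eq_bigr => i _.
      by ring.
    by move=> i _; ring.
  have s1 j : \sum_l f j * f l * (e j l *+ 2) = N.+1%:R * (f j ^+ 2 *+ 2).
    rewrite (bigD1 j)//= big1 => [|l lj].
      by rewrite eE eqxx addr0; ring.
    by rewrite eE eqm eq_sym (negbTE lj) mul0rn mulr0.
  have s2 j : \sum_l f j * f l * e (j + k)%N l = N.+1%:R * (f j * f (j + k)).
    rewrite (bigD1 (j + k))// big1 => [|l lj].
      by rewrite eE addm modn_mod eqxx /= addr0; ring.
    by rewrite eE -modn_mod -addm eqm eq_sym (negbTE lj) mulr0.
  have s3 l : \sum_j f j * f l * e j (l + k)%N = N.+1%:R * (f l * f (l + k)).
    rewrite (bigD1 (l + k))// big1 => [|j lj].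
      by rewrite eE addm modn_mod eqxx /= addr0; ring.
    rewrite eE; have -> : (j == l + k %[mod N.+1])%N = (j == l + k).
      by rewrite -(modn_mod (l + k)) -addm eqm.
    by rewrite (negbTE lj) mulr0.
  rewrite [RHS](eq_bigr (fun j =>
       (N.+1%:R * (f j ^+ 2 *+ 2) - N.+1%:R * (f j * f (j + k)))
     - \sum_l f j * f l * e j (l + k)%N)); last first.
    move=> j _; rewrite -s1 -s2 -!sumrB; apply: eq_bigr => l _; ring.
  rewrite [RHS]sumrB [X in _ = _ - X]exchange_big/=.
  rewrite [X in _ = _ - X](eq_bigr (fun l => N.+1%:R * (f l * f (l + k)))) //.
  rewrite -sumrB mulr_sumr.
  by apply: eq_bigr => i _; ring.
(* Now [e] is read as a sum of cosines: with [A] the angle between [j] and [l] and [B] that of the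
   shift, [2 cos A - cos (A + B) - cos (A - B) = 2 cos A (1 - cos B)]. *)
transitivity (\sum_j \sum_l \sum_(m < N.+1) f j * f l *
   (cos (m%:R * (2 * (j%:R * h))) * cos (m%:R * (2 * (l%:R * h)))
    + sin (m%:R * (2 * (j%:R * h))) * sin (m%:R * (2 * (l%:R * h))))
   * (4 * sin (k%:R * (m%:R * h)) ^+ 2)).
  apply: eq_bigr => j _; apply: eq_bigr => l _.
  rewrite /e -sumrMnl -!sumrB mulr_sumr; apply: eq_bigr => m _.
  rewrite -cosB !natrD.
  set A := _ - m%:R * (2 * (l%:R * h)); set B := m%:R * (2 * (k%:R * h)).
  have -> : m%:R * (2 * ((j%:R - l%:R) * h)) = A by rewrite /A; ring.
  have -> : m%:R * (2 * ((j%:R + k%:R - l%:R) * h)) = A + B by rewrite /A /B; ring.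
  have -> : m%:R * (2 * ((j%:R - (l%:R + k%:R)) * h)) = A - B.
    by rewrite /A /B; ring.
  have -> : 4 * sin (k%:R * (m%:R * h)) ^+ 2 = (1 - cos B) *+ 2.
    have -> : B = (k%:R * (m%:R * h)) *+ 2 by rewrite /B -mulr_natr; ring.
    by rewrite cos_mulr2n sin2cos2; ring.
  by clearbody A B; rewrite cosD cosB; ring.
under eq_bigr do rewrite exchange_big/=.
rewrite exchange_big/=; apply: eq_bigr => m _.
under eq_bigr do rewrite -mulr_suml.
rewrite -mulr_suml; congr (_ * _).
rewrite !expr2 !mulr_suml -big_split/=; apply: eq_bigr => j _.
rewrite !mulr_sumr -big_split/=; apply: eq_bigr => l _; ring.
Qed.

(** Both sides are sums over the modes with the same nonnegative weights. The mode 0 contributes to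
    neither, and the others are compared by [sqr_sin_ratio]. *)
Lemma sum_sqr_diff_le (R : realType) (N : nat) (f : 'I_N.+2 -> R)
    (k : 'I_N.+2) : k != 0 ->
  sin (pi / N.+2%:R) ^+ 2 * \sum_i (f (i + k) - f i) ^+ 2
  <= sin (k%:R * (pi / N.+2%:R)) ^+ 2 * \sum_i (f (i + 1) - f i) ^+ 2.
Proof.
move=> k0; rewrite -(ler_pM2l (_ : 0 < N.+2%:R :> R))// !(mulrCA N.+2%:R).
rewrite !sum_sqr_diff_fourier !mulr_sumr ler_sum// => m _.
set P := (_ ^+ 2 + _ ^+ 2); have P0 : 0 <= P by rewrite addr_ge0 ?sqr_ge0.
have [->|m0] := eqVneq m 0.
  by rewrite mul0r !mulr0 sin0 expr0n !mulr0.
rewrite mulrCA [leRHS]mulrCA ler_wpM2l// mulrCA [leRHS]mulrCA ler_wpM2l//.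
rewrite mul1r mulrC; apply: sqr_sin_ratio.
- by rewrite ltn_ord andbT lt0n.
- by rewrite ltn_ord andbT lt0n.
Qed.

(** * Rigidity of the energy *)

Lemma dotp_ge0 (R : realType) (d : nat) (v : 'rV[R]_d) : 0 <= dotp v v.
Proof. by apply: sumr_ge0 => i _; rewrite -expr2 sqr_ge0. Qed.

Lemma sqr_enorm (R : realType) (d : nat) (v : 'rV[R]_d) : enorm v ^+ 2 = dotp v v.
Proof. by rewrite sqr_sqrtr// dotp_ge0. Qed.

Lemma enorm_ge0 (R : realType) (d : nat) (v : 'rV[R]_d) : 0 <= enorm v.
Proof. exact: sqrtr_ge0. Qed.

(* Squared distance between the vertices [i] and [j] of the regular [n]-gon
   with edges of length [1 / n]. *)
Definition chord2 (R : realType) (n i j : nat) : R :=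
  sin ((i%:R - j%:R) * (pi / n%:R)) ^+ 2 / (n%:R * sin (pi / n%:R)) ^+ 2.

Lemma sin_pi_gt0 (R : realType) (n : nat) : (1 < n)%N -> 0 < sin (pi / n%:R : R).
Proof.
move=> n1; have pi0 := @pi_gt0 R.
apply: sin_gt0_pi; rewrite divr_gt0 ?ltr0n ?(ltn_trans _ n1)//=.
by rewrite gtr_pMr// invf_lt1 ?ltr0n ?(ltn_trans _ n1)// ltr1n.
Qed.

Lemma chord2C (R : realType) (n i j : nat) : chord2 R n i j = chord2 R n j i.
Proof.
rewrite /chord2; congr (_ / _); rewrite -[in LHS]sqrrN -sinN.
by congr (sin _ ^+ 2); ring.
Qed.

(** Wrapping around changes the angle by [pi], which the squared sine does not see. *)
Lemma chord2_modn (R : realType) (n i k : nat) : (0 < n)%N -> (i < n)%N ->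
  (k < n)%N -> chord2 R n ((i + k) %% n)%N i = chord2 R n k 0.
Proof.
move=> n0 lin lkn; have n0R : n%:R != 0 :> R by rewrite pnatr_eq0 -lt0n.
rewrite /chord2; congr (_ / _); rewrite subr0.
have [h|h] := ltnP (i + k) n.
  by rewrite modn_small// natrD [i%:R + _]addrC addrK.
have -> : ((i + k) %% n = i + k - n)%N.
  by rewrite -[in LHS](subnK h) modnDr modn_small//; lia.
rewrite natrB// natrD.
have -> : (i%:R + k%:R - n%:R - i%:R) * (pi / n%:R)
  = - (1%:R * pi - k%:R * (pi / n%:R)) :> R by field.
by rewrite sinN sqrrN sqr_sin_npiB.
Qed.

Lemma chord2_gt0 (R : realType) (n i j : nat) : (1 < n)%N -> (i < n)%N ->
  (j < n)%N -> i != j -> 0 < chord2 R n i j.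
Proof.
move=> n1; wlog ji : i j / (j < i)%N => [hw|] lin ljn ij.
  move: ij; rewrite neq_ltn => /orP[h|h]; last by apply: hw => //; rewrite gtn_eqF.
  by rewrite chord2C; apply: hw => //; rewrite gtn_eqF.
apply: divr_gt0.
  rewrite exprn_even_gt0//= -natrB ?(ltnW ji)// sin_pi_frac_eq0; last exact: ltnW.
  by apply/negP => /dvdn_leq; lia.
by rewrite exprn_gt0// mulr_gt0 ?sin_pi_gt0// ltr0n ltnW.
Qed.

Lemma sum_sqr_dist_le (R : realType) (d N : nat) (x : 'I_N.+2 -> 'rV[R]_d)
    (k : 'I_N.+2) : k != 0 ->
  sin (pi / N.+2%:R) ^+ 2 * \sum_i enorm (x (i + k) - x i) ^+ 2
  <= sin (k%:R * (pi / N.+2%:R)) ^+ 2 * \sum_i enorm (x (i + 1) - x i) ^+ 2.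
Proof.
move=> k0.
have exch (l : 'I_N.+2) : \sum_i enorm (x (i + l) - x i) ^+ 2
    = \sum_(c < d) \sum_i (x (i + l) 0 c - x i 0 c) ^+ 2.
  rewrite exchange_big/=; apply: eq_bigr => i _; rewrite sqr_enorm.
  by apply: eq_bigr => c _; rewrite !mxE expr2.
rewrite !exch !mulr_sumr; apply: ler_sum => c _.
exact: (sum_sqr_diff_le (fun i => x i 0 c)).
Qed.

(* The tangent line of [1 / D] at [S] gives [1 / D >= 2 / S - D / S ^ 2], with
   equality only for [D = S]. *)
Lemma energy_rigidity (R : realType) (d N : nat) (x : 'I_N.+2 -> 'rV[R]_d) :
  (forall i, enorm (x (i + 1) - x i) = N.+2%:R^-1) ->
  (forall i j, i != j -> enorm (x i - x j) != 0) ->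
  \sum_i \sum_(j | j != i) (enorm (x j - x i) ^+ 2)^-1
    <= \sum_(i < N.+2) \sum_(j < N.+2 | j != i) (chord2 R N.+2 j i)^-1 ->
  forall i j, enorm (x j - x i) ^+ 2 = chord2 R N.+2 j i.
Proof.
move=> edge inj le.
pose D i j := enorm (x j - x i) ^+ 2.
pose S (i j : 'I_N.+2) := chord2 R N.+2 j i.
have D0 i j : j != i -> 0 < D i j.
  by move=> ji; rewrite exprn_gt0// lt_def enorm_ge0 inj.
have S0 (i j : 'I_N.+2) : j != i -> 0 < S i j.
  by move=> ji; apply: chord2_gt0.
have sn0 := sin_pi_gt0 R (isT : 1 < N.+2)%N.
(* The pairs are grouped by their shift [k = j - i], on which the regular chord [S] is constant. *)
have reidx (F : 'I_N.+2 -> 'I_N.+2 -> R) : \sum_i \sum_(j | j != i) F i j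
    = \sum_(k | k != 0) \sum_i F i (i + k).
  rewrite [RHS]exchange_big/=; apply: eq_bigr => i _.
  rewrite (reindex_inj (addrI i))/=; apply: eq_bigl => k.
  by rewrite -{2}[i]addr0 (inj_eq (addrI i)).
have Sk (i k : 'I_N.+2) : S i (i + k) = chord2 R N.+2 k 0.
  by rewrite /S; apply: chord2_modn.
(* For a fixed shift, the mean of [D] is at most [S] by [sum_sqr_dist_le], whose right-hand side is
   known because all the edges have length [1 / n]. *)
have avg : \sum_i \sum_(j | j != i) D i j / S i j ^+ 2
    <= \sum_i \sum_(j | j != i) (S i j)^-1.
  rewrite !reidx; apply: ler_sum => k k0.
  under eq_bigr do rewrite Sk. under [leRHS]eq_bigr do rewrite Sk.
  have c0 : 0 < chord2 R N.+2 k 0 by apply: chord2_gt0.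
  rewrite -mulr_suml ler_pdivrMr ?exprn_gt0// sumr_const card_ord.
  rewrite mulrnAl expr2 mulKf ?gt_eqF//.
  have := sum_sqr_dist_le x k0.
  rewrite [X in _ <= _ * X](eq_bigr (fun=> N.+2%:R^-1 ^+ 2)) => [|i _]; last first.
    by rewrite edge.
  rewrite sumr_const card_ord -ler_pdivlMl ?exprn_gt0// => /le_trans; apply.
  rewrite /chord2 subr0 le_eqVlt; apply/orP; left; apply/eqP.
  rewrite -mulr_natl; field.
  by rewrite mulr1 gt_eqF//= -natrD pnatr_eq0.
(* [T] is the gap between [1 / D] and its tangent line at [S]. It is nonnegative, while [avg] and
   the bound on the energy make its total at most 0, so every gap vanishes. *)
pose T i j := (D i j)^-1 - (S i j)^-1 *+ 2 + D i j / S i j ^+ 2.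
have TE i j : j != i -> T i j = (D i j - S i j) ^+ 2 / (D i j * S i j ^+ 2).
  move=> ji; rewrite /T; field.
  by rewrite !gt_eqF ?D0 ?S0.
have T0 i j : j != i -> 0 <= T i j.
  move=> ji; rewrite TE//.
  by rewrite divr_ge0 ?sqr_ge0// mulr_ge0 ?sqr_ge0.
have sumT : \sum_i \sum_(j | j != i) T i j = 0.
  apply/eqP; rewrite eq_le sumr_ge0 ?andbT; last by move=> i _; apply: sumr_ge0 => j /T0.
  rewrite (eq_bigr (fun i => (\sum_(j | j != i) (D i j)^-1
    - (\sum_(j | j != i) (S i j)^-1) *+ 2)
    + \sum_(j | j != i) D i j / S i j ^+ 2)); last first.
    by move=> i _; rewrite -sumrMnl -sumrB -big_split.
  rewrite big_split/= sumrB sumrMnl.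
  have {}le : \sum_i \sum_(j | j != i) (D i j)^-1
    <= \sum_i \sum_(j | j != i) (S i j)^-1 by [].
  lra.
move=> i j; have [->|ji] := eqVneq j i.
  rewrite subrr sqr_enorm /dotp big1 => [|c _]; last by rewrite !mxE mul0r.
  by rewrite /chord2 subrr mul0r sin0 expr0n mul0r.
have : T i j = 0.
  have /psumr_eq0P h := sumT.
  have {}h : \sum_(j | j != i) T i j = 0.
    by apply: h => // l _; apply: sumr_ge0 => m /T0.
  by have /psumr_eq0P := h; apply => // m /T0.
rewrite TE// => /eqP; rewrite mulf_eq0 => /orP[|].
  by rewrite sqrf_eq0 subr_eq0 => /eqP.
by rewrite invr_eq0 gt_eqF// mulr_gt0 ?D0// exprn_gt0// S0.
Qed.

(** * Reconstruction of a polygon from its mutual distances *)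

Lemma dotpC (R : realType) (d : nat) (u v : 'rV[R]_d) : dotp u v = dotp v u.
Proof. by apply: eq_bigr => i _; rewrite mulrC. Qed.

Lemma dotpDl (R : realType) (d : nat) (u v w : 'rV[R]_d) :
  dotp (u + v) w = dotp u w + dotp v w.
Proof. by rewrite -big_split/=; apply: eq_bigr => i _; rewrite mxE mulrDl. Qed.

Lemma dotpZl (R : realType) (d : nat) (k : R) (u v : 'rV[R]_d) :
  dotp (k *: u) v = k * dotp u v.
Proof. by rewrite mulr_sumr; apply: eq_bigr => i _; rewrite mxE mulrA. Qed.

Lemma dotpDr (R : realType) (d : nat) (u v w : 'rV[R]_d) :
  dotp u (v + w) = dotp u v + dotp u w.
Proof. by rewrite !(dotpC u) dotpDl. Qed.

Lemma dotpZr (R : realType) (d : nat) (k : R) (u v : 'rV[R]_d) :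
  dotp u (k *: v) = k * dotp u v.
Proof. by rewrite !(dotpC u) dotpZl. Qed.

Lemma dotpBl (R : realType) (d : nat) (u v w : 'rV[R]_d) :
  dotp (u - v) w = dotp u w - dotp v w.
Proof. by rewrite dotpDl -scaleN1r dotpZl mulN1r. Qed.

Lemma dotpBr (R : realType) (d : nat) (u v w : 'rV[R]_d) :
  dotp u (v - w) = dotp u v - dotp u w.
Proof. by rewrite !(dotpC u) dotpBl. Qed.

Lemma dotp_suml (R : realType) (d : nat) (I : finType) (x : I -> 'rV[R]_d) v :
  dotp (\sum_i x i) v = \sum_i dotp (x i) v.
Proof.
rewrite /dotp exchange_big/=; apply: eq_bigr => c _.
by rewrite summxE mulr_suml.
Qed.

Lemma dotp_sumr (R : realType) (d : nat) (I : finType) (x : I -> 'rV[R]_d) v :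
  dotp v (\sum_i x i) = \sum_i dotp v (x i).
Proof. by rewrite dotpC dotp_suml; apply: eq_bigr => i _; rewrite dotpC. Qed.

Lemma dotp_eq0 (R : realType) (d : nat) (v : 'rV[R]_d) : dotp v v = 0 -> v = 0.
Proof.
move=> /psumr_eq0P h; apply/rowP => c; rewrite mxE.
have /eqP := h (fun i _ => ltac:(rewrite -expr2; exact: sqr_ge0)) c isT.
by rewrite -expr2 sqrf_eq0 => /eqP.
Qed.

(** Read [g] and [h] as Gram matrices that induce the same squared distances: they differ by a
    function of [i] plus a function of [j], and weights of total 0 annihilate both. *)
Lemma polarization_sum (R : realType) (I : finType) (w z : I -> R)
    (g h : I -> I -> R) :
  \sum_i w i = 0 -> \sum_i z i = 0 ->
  (forall i j, g i i + g j j - g i j *+ 2 = h i i + h j j - h i j *+ 2) ->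
  \sum_i \sum_j w i * z j * g i j = \sum_i \sum_j w i * z j * h i j.
Proof.
move=> w0 z0 gh.
have gE i j : g i j = h i j + (g i i - h i i) / 2 + (g j j - h j j) / 2.
  by have := gh i j; lra.
transitivity (\sum_i (\sum_j w i * z j * h i j
   + (w i * ((g i i - h i i) / 2) * \sum_j z j
   + w i * \sum_j z j * ((g j j - h j j) / 2)))).
  apply: eq_bigr => i _; rewrite !mulr_sumr -!big_split/=; apply: eq_bigr => j _.
  by rewrite [g i j]gE; ring.
rewrite z0 big_split/=; under [X in _ + X]eq_bigr do rewrite mulr0 add0r.
by rewrite -mulr_suml w0 mul0r addr0.
Qed.

(* Inner products of combinations with total weight 0 only depend on the mutual
   distances, so the affine relations between the points [(a i, b i)] also hold
   between the points [x i]. *)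
Lemma congruent_planar (R : realType) (d : nat) (I : finType)
    (x : I -> 'rV[R]_d) (a b wo wu wv : I -> R) :
  (forall i j, enorm (x j - x i) ^+ 2 = (a j - a i) ^+ 2 + (b j - b i) ^+ 2) ->
  \sum_i wo i = 1 -> \sum_i wu i = 0 -> \sum_i wv i = 0 ->
  \sum_i wo i * a i = 0 -> \sum_i wo i * b i = 0 ->
  \sum_i wu i * a i = 1 -> \sum_i wu i * b i = 0 ->
  \sum_i wv i * a i = 0 -> \sum_i wv i * b i = 1 ->
  exists o u v : 'rV[R]_d, [/\ dotp u u = 1, dotp v v = 1, dotp u v = 0 &
    forall i, x i = o + (a i *: u + b i *: v)].
Proof.
move=> dist wo1 wu0 wv0 woa wob wua wub wva wvb.
pose comb (w : I -> R) := \sum_i w i *: x i.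
have gram (w z : I -> R) : \sum_i w i = 0 -> \sum_i z i = 0 ->
    dotp (comb w) (comb z)
    = (\sum_i w i * a i) * (\sum_i z i * a i)
      + (\sum_i w i * b i) * (\sum_i z i * b i).
  move=> w0 z0.
  transitivity (\sum_i \sum_j w i * z j * dotp (x i) (x j)).
    rewrite /comb dotp_suml; apply: eq_bigr => i _.
    rewrite dotp_sumr; apply: eq_bigr => j _.
    by rewrite dotpZl dotpZr mulrA.
  rewrite (@polarization_sum _ _ _ _ _ (fun i j => a i * a j + b i * b j))//.
    rewrite !mulr_suml -big_split/=; apply: eq_bigr => i _.
    rewrite !mulr_sumr -big_split/=; apply: eq_bigr => j _; ring.
  move=> i j; have := dist i j; rewrite sqr_enorm !(dotpBl, dotpBr) (dotpC (x j)).
  by lra.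
exists (comb wo), (comb wu), (comb wv); split.
- by rewrite gram// wua wub; ring.
- by rewrite gram// wva wvb; ring.
- by rewrite gram// wva wvb wua wub; ring.
move=> k; apply/eqP; rewrite -subr_eq0; apply/eqP; apply: dotp_eq0.
(* These weights express the error [x k - (o + a k u + b k v)]. Their total and both planar moments
   are 0, so [gram] gives the error norm 0. *)
pose wk i := (i == k)%:R - (wo i + (a k * wu i + b k * wv i)).
have wkE (f : I -> R) : \sum_i wk i * f i = f k - (\sum_i wo i * f i
    + (a k * (\sum_i wu i * f i) + b k * (\sum_i wv i * f i))).
  transitivity (\sum_i (i == k)%:R * f i - (\sum_i wo i * f i
    + (a k * (\sum_i wu i * f i) + b k * (\sum_i wv i * f i)))).
    rewrite !mulr_sumr -!big_split/= -sumrB; apply: eq_bigr => i _.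
    by rewrite /wk; ring.
  congr (_ - _); rewrite (bigD1 k)//= eqxx mul1r big1 ?addr0// => i /negbTE->.
  by rewrite mul0r.
have -> : x k - (comb wo + (a k *: comb wu + b k *: comb wv)) = comb wk.
  apply/rowP => c; rewrite !mxE !summxE.
  under eq_bigr do rewrite mxE. under [X in _ * X + _]eq_bigr do rewrite mxE.
  under [X in _ + _ * X]eq_bigr do rewrite mxE.
  by under [RHS]eq_bigr do rewrite mxE; rewrite (wkE (fun i => x i 0 c)).
have wk0 : \sum_i wk i = 0.
  have e1 (w : I -> R) : \sum_i w i * 1 = \sum_i w i.
    by apply: eq_bigr => i _; rewrite mulr1.
  by have := wkE (fun=> 1); rewrite !e1 => ->; rewrite wo1 wu0 wv0; ring.
by rewrite gram// !wkE woa wob wua wub wva wvb; ring.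
Qed.

Definition circumradius (R : realType) (n : nat) : R :=
  (2 * (n%:R * sin (pi / n%:R)))^-1.

Lemma circumradius_gt0 (R : realType) (n : nat) : (1 < n)%N ->
  0 < circumradius R n.
Proof.
by move=> n1; rewrite invr_gt0 !mulr_gt0 ?sin_pi_gt0// ltr0n ltnW.
Qed.

Definition vertex_angle (R : realType) (n i : nat) : R :=
  2 * (i%:R * (pi / n%:R)).

(** A chord of a circle of radius [r] seen under the angle [t] has length [2 r sin (t / 2)]. This
    gives the planar coordinates that [congruent_planar] asks for. *)
Lemma chord2E (R : realType) (n i j : nat) (r := circumradius R n)
    (t := vertex_angle R n) :
  chord2 R n i j = (r * cos (t i) - r * cos (t j)) ^+ 2
                 + (r * sin (t i) - r * sin (t j)) ^+ 2.
Proof.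
have -> : chord2 R n i j
    = r ^+ 2 * (4 * sin ((i%:R - j%:R) * (pi / n%:R)) ^+ 2).
  rewrite /chord2 /r /circumradius -exprVn (invfM 2).
  by move: (_ * _)^-1 => A; field.
have -> : 4 * sin ((i%:R - j%:R) * (pi / n%:R)) ^+ 2 = (1 - cos (t i - t j)) *+ 2.
  have -> : t i - t j = ((i%:R - j%:R) * (pi / n%:R)) *+ 2.
    by rewrite /t /vertex_angle mulr2n; ring.
  by rewrite cos_mulr2n sin2cos2; ring.
have [hi hj] := (cos2Dsin2 (t i), cos2Dsin2 (t j)); rewrite cosB.
move: (cos (t i)) (sin (t i)) (cos (t j)) (sin (t j)) hi hj => ci si cj sj hi hj.
have -> : 1 = (ci ^+ 2 + si ^+ 2) / 2 + (cj ^+ 2 + sj ^+ 2) / 2 by rewrite hi hj; field.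
by field.
Qed.

Lemma regular_polygon_of_dist (R : realType) (d N : nat)
    (x : 'I_N.+3 -> 'rV[R]_d) (r := circumradius R N.+3)
    (t := vertex_angle R N.+3) :
  (forall i j, enorm (x j - x i) ^+ 2 = chord2 R N.+3 j i) ->
  exists o u v : 'rV[R]_d, [/\ dotp u u = 1, dotp v v = 1, dotp u v = 0 &
    forall i, x i = o + ((r * cos (t i)) *: u + (r * sin (t i)) *: v)].
Proof.
move=> dist.
pose i0 := @Ordinal N.+3 0 isT; pose i1 := @Ordinal N.+3 1 isT.
pose i2 := @Ordinal N.+3 2 isT.
pose w3 (a b c : R) (i : 'I_N.+3) :=
  a * (i == i0)%:R + b * (i == i1)%:R + c * (i == i2)%:R.
have sdelta (j : 'I_N.+3) (f : 'I_N.+3 -> R) : \sum_i (i == j)%:R * f i = f j.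
  rewrite (bigD1 j)//= eqxx mul1r big1 ?addr0// => i /negbTE->.
  by rewrite mul0r.
have w3E a b c f : \sum_i w3 a b c i * f i = a * f i0 + b * f i1 + c * f i2.
  rewrite -(sdelta i0) -(sdelta i1) -(sdelta i2) !mulr_sumr -!big_split/=.
  by apply: eq_bigr => i _; rewrite /w3; ring.
have w3s a b c : \sum_i w3 a b c i = a + b + c.
  by have := w3E a b c (fun=> 1); under eq_bigr do rewrite mulr1; rewrite !mulr1.
pose C := cos (t 1%N); pose S := sin (t 1%N).
have CS : S ^+ 2 = 1 - C ^+ 2 by rewrite /C /S sin2cos2.
have t0 : t 0%N = 0 by rewrite /t /vertex_angle mul0r mulr0.
have t2 : t 2%N = t 1%N *+ 2 by rewrite /t /vertex_angle mulr2n; ring.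
have S0 : S != 0.
  rewrite /S /t /vertex_angle.
  have -> : 2 * (1%:R * (pi / N.+3%:R)) = 2%:R * (pi / N.+3%:R) :> R by ring.
  by rewrite sin_pi_frac_eq0.
have C1 : 1 - C != 0.
  apply/eqP => h; move/eqP: CS.
  rewrite (_ : 1 - C ^+ 2 = (1 - C) * (1 + C)); last by ring.
  by rewrite h mul0r sqrf_eq0 (negbTE S0).
have r0 : r != 0 by rewrite gt_eqF// circumradius_gt0.
(* By reflection in the axis through vertex 1, the center has weights [K], [1 - 2 K], [K]. Its
   second coordinate [r S (1 - 2 K + 2 K C)] vanishes for this [K]. The axes are then [(x0 - o) / r]
   and [(x1 - o - C (x0 - o)) / (r S)]. *)
pose K := (2 - 2 * C)^-1.
have c2 : cos (t 1%N *+ 2) = 2 * C ^+ 2 - 1 by rewrite cos_mulr2n /C; ring.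
have s2 : sin (t 1%N *+ 2) = 2 * (C * S) by rewrite sin_mulr2n /C /S; ring.
(* Center and axes of the regular polygon, as combinations of the first three
   vertices. *)
apply: (@congruent_planar _ _ _ _ _ _ (w3 K (1 - 2 * K) K)
  (w3 ((1 - K) / r) (- (1 - 2 * K) / r) (- K / r))
  (w3 ((- K - C * (1 - K)) / (r * S)) ((2 * K + C * (1 - 2 * K)) / (r * S))
      ((C * K - K) / (r * S)))).
- by move=> i j; rewrite dist chord2E.
all: rewrite ?w3E ?w3s /= ?t0 ?t2 ?cos0 ?sin0 ?c2 ?s2 -/C -/S.
all: have -> : K = (2 - 2 * C)^-1 by [].
all: have C2 : 2 - 2 * C != 0
  by rewrite (_ : 2 - 2 * C = 2 * (1 - C)) ?mulf_neq0//; ring.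
all: field; rewrite ?r0 ?S0 ?C2//.
Qed.

(** * Equilateral polygons *)

Lemma near_affine_is_derive (R : realType) (d : nat) (f : R -> 'rV[R]_d)
    (v w : 'rV[R]_d) (t : R) :
  (\forall s \near t, v + s *: w = f s) -> is_derive t 1 f w.
Proof.
move=> /near_eq_is_derive; apply.
have q : (fun h : R => h^-1 *: (((fun s : R => v + s *: w) \o shift t) (h *: 1)
    - (v + t *: w))) @ (0 : R)^' --> w.
  apply: cvg_near_cst; near=> h.
  have h0 : h != 0 by near: h; exact: nbhs_dnbhs_neq.
  rewrite /= /GRing.scale/= mulr1 -/(GRing.scale _ _) opprD addrACA subrr add0r.
  by rewrite -scalerBl addrK scalerA mulVf// scale1r.
by apply: DeriveDef; [apply/cvg_ex; exists w | exact: cvg_lim].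
Unshelve. all: by end_near. Qed.

Lemma cdistE (R : realType) (s t s' t' : R) : s - t = s' - t' ->
  cdist s t = cdist s' t'.
Proof. by rewrite /cdist => ->. Qed.

Lemma has_inf_cdist (R : realType) (s t : R) :
  has_inf [set `|s - t + k%:~R| | k in [set: int]].
Proof.
split; first by exists `|s - t + 0%:~R|, 0.
by exists 0 => _ [k _ <-].
Qed.

Lemma cdist_le (R : realType) (s t : R) : t <= s -> cdist s t <= s - t.
Proof.
move=> ts; apply: ge_inf; first exact: (has_inf_cdist s t).2.
by exists 0 => //; rewrite addr0 ger0_norm// subr_ge0.
Qed.

(** As [1 / n <= 1 / 2], going around the other way is not shorter. *)
Lemma cdist_inv (R : realType) (n : nat) (s t : R) : (1 < n)%N ->
  s - t = n%:R^-1 -> cdist s t = n%:R^-1.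
Proof.
move=> n1 st; have n0 : 0 < n%:R :> R by rewrite ltr0n ltnW.
have v0 : 0 < n%:R^-1 :> R by rewrite invr_gt0.
have v1 : n%:R^-1 <= 2^-1 :> R by rewrite lef_pV2 ?posrE// ler_nat.
apply/eqP; rewrite eq_le -{1}st cdist_le/=; last by rewrite -subr_ge0 st ltW.
apply: lb_le_inf; first exact: (has_inf_cdist s t).1.
move=> _ [k _ <-]; rewrite st.
have [k0|k0] := leP 0 k.
  rewrite ger0_norm ?addr_ge0 ?ler0z ?(ltW v0)//.
  by rewrite lerDl ler0z.
have k1 : (k + 1)%:~R <= 0 :> R by rewrite lerz0 lezD1.
rewrite intrD in k1.
rewrite ler0_norm; last lra.
lra.
Qed.

Section Vertices.
Variables (R : realType) (d n : nat) (p : R -> 'rV[R]_d) (a : nat -> R).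
Hypotheses (n0 : (0 < n)%N) (va : vertices n p a).

(** [vertices] prescribes only the intrinsic distance, which a long arc could also realise. But each
    gap is at least that distance [1 / n], and [n] successive gaps make exactly one turn, so none is
    longer. *)
Lemma vertices_step i : a i.+1 = a i + n%:R^-1.
Proof.
case: va => inc per cd _; have n0R : n%:R != 0 :> R by rewrite pnatr_eq0 -lt0n.
have step j : n%:R^-1 <= a j.+1 - a j by rewrite -(cd j) cdist_le// ltW.
have tot m : \sum_(j < m) (a (i + j)%N.+1 - a (i + j)%N - n%:R^-1)
    = a (i + m)%N - a i - m%:R / n%:R.
  elim: m => [|m IH]; first by rewrite big_ord0 addn0 mul0r subrr subr0.
  by rewrite big_ord_recr/= IH addnS -natr1; field.
have /eqP : \sum_(j < n) (a (i + j)%N.+1 - a (i + j)%N - n%:R^-1) = 0.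
  by rewrite tot per divff//; ring.
rewrite psumr_eq0 => [|j _]; last by rewrite subr_ge0.
move=> /allP/(_ (Ordinal n0) (mem_index_enum _))/eqP /=.
by rewrite addn0; lra.
Qed.

Lemma verticesE i : a i = a 0%N + i%:R / n%:R.
Proof.
elim: i => [|i IH]; first by rewrite mul0r addr0.
by rewrite vertices_step IH -natr1 mulrDl mul1r addrA.
Qed.

(** An arc has positive measure, so it contains in its interior a point where the speed is 1. The
    curve is affine there, so this is its speed on the whole arc. *)
Lemma vertices_edge i :
  {ae lebesgue_measure, forall t : R, derivable p t 1 /\ enorm (derive1 p t) = 1} ->
  enorm (p (a i.+1) - p (a i)) = n%:R^-1.
Proof.
move=> [B [mB B0 sB]]; case: va => inc _ _ /(_ i)[v [w pE]].
have [t [at1 at2] Bt] : exists2 t : R, a i < t /\ t < a i.+1 & ~ B t.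
  apply: contrapT => h.
  have : (lebesgue_measure `]a i, a i.+1[ <= lebesgue_measure B)%E.
    apply: le_measure; rewrite ?inE; [exact: measurable_itv|exact: mB|].
    move=> t /=; rewrite in_itv/= => /andP[t1 t2].
    by apply: contrapT => nB; apply: h; exists t.
  rewrite B0 lebesgue_measure_itv/= lte_fin inc -EFinD lee_fin.
  by rewrite leNgt subr_gt0 inc.
have [_] : derivable p t 1 /\ enorm (derive1 p t) = 1.
  by apply: contrapT => h; apply: Bt; apply: (sB t) => Pt; exact: h.
have dw : is_derive t 1 p w.
  apply: (@near_affine_is_derive _ _ _ v).
  have tI : t \in `]a i, a i.+1[ by rewrite in_itv/= at1.
  apply: filterS (near_in_itvoo tI) => s; rewrite in_itv/= => /andP[s1 s2].
  by rewrite pE// !ltW.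
rewrite derive1E derive_val => w1.
rewrite !pE ?lexx ?ltW// opprD addrACA subrr add0r -scalerBl.
have n0R : 0 < n%:R :> R by rewrite ltr0n.
rewrite vertices_step addrAC subrr add0r /enorm dotpZl dotpZr mulrA -expr2.
rewrite sqrtrM ?sqr_ge0// sqrtr_sqr ger0_norm ?invr_ge0 ?ltW// -[Num.sqrt _]/(enorm w).
by rewrite w1 mulr1.
Qed.

End Vertices.

(* The regular [n]-gon with edges of length [1 / n], parametrised by arc length:
   [node n t] is the parameter of the last vertex before [t], and
   [(ngon_dx n t, ngon_dy n t)] is the direction of the edge through [t]. *)
Definition node (R : realType) (n : nat) (t : R) : R :=
  (Num.floor (n%:R * t))%:~R / n%:R.

Definition ngon_dx (R : realType) (n : nat) (t : R) : R :=
  - sin (2 * pi * node n t + pi / n%:R).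

Definition ngon_dy (R : realType) (n : nat) (t : R) : R :=
  cos (2 * pi * node n t + pi / n%:R).

Definition ngon_x (R : realType) (n : nat) (t : R) : R :=
  circumradius R n * cos (2 * pi * node n t) + (t - node n t) * ngon_dx n t.

Definition ngon_y (R : realType) (n : nat) (t : R) : R :=
  circumradius R n * sin (2 * pi * node n t) + (t - node n t) * ngon_dy n t.

Definition ngon (R : realType) (d n : nat) (o u v : 'rV[R]_d) (t : R) : 'rV[R]_d :=
  o + (ngon_x n t *: u + ngon_y n t *: v).

Section Ngon.
Variables (R : realType) (n : nat).
Hypothesis n1 : (1 < n)%N.
Implicit Types t : R.

Let n0R : n%:R != 0 :> R.
Proof. by rewrite pnatr_eq0 -lt0n ltnW. Qed.

Let n_gt0 : 0 < n%:R :> R.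
Proof. by rewrite ltr0n ltnW. Qed.

Lemma node_eq (k : int) t :
  k%:~R / n%:R <= t -> t < (k%:~R + 1) / n%:R -> node n t = k%:~R / n%:R.
Proof.
rewrite ler_pdivrMr// ltr_pdivlMr// => h1 h2; rewrite /node (floor_def (m := k))//.
by rewrite intrD [n%:R * t]mulrC h1.
Qed.

Lemma node_le t : node n t <= t.
Proof. by rewrite /node ler_pdivrMr// [leRHS]mulrC floor_le_tmp. Qed.

Lemma node_gt t : t < node n t + n%:R^-1.
Proof.
rewrite -(ltr_pM2l n_gt0) mulrDr divff// /node mulrCA divff// mulr1.
by have /andP[_] := floor_itv (n%:R * t); rewrite intrD.
Qed.

Lemma nodeD (k : int) t : node n (t + k%:~R / n%:R) = node n t + k%:~R / n%:R.
Proof.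
rewrite /node mulrDr (mulrCA n%:R) divff// mulr1 floorDrz ?intr_int//.
by rewrite intrKfloor intrD mulrDl.
Qed.

Lemma sin2intpi (k : int) t : sin (t + 2 * pi * k%:~R) = sin t.
Proof.
elim/int_rec: k t => [|k IH|k IH] t.
- by rewrite mulr0 addr0.
- have -> : t + 2 * pi * k.+1%:~R = t + pi *+ 2 + 2 * pi * k%:~R.
    by rewrite -!pmulrn -natr1 mulr2n; ring.
  by rewrite IH sinD2pi.
- rewrite -(sinD2pi _); have -> : t + 2 * pi * (- (k.+1)%:~R) + pi *+ 2
      = t + 2 * pi * (- k%:Z)%:~R.
    by rewrite !intrN -!pmulrn -natr1 mulr2n; ring.
  exact: IH.
Qed.

Lemma cos2intpi (k : int) t : cos (t + 2 * pi * k%:~R) = cos t.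
Proof. by rewrite -!sinDpihalf addrAC sin2intpi. Qed.

(** The edge that starts at angle [t] is tangent to the circle at its middle angle [t + pi / n].
    With [ngon_edge_y], this makes consecutive pieces of [ngon] match at the corners. *)
Lemma ngon_edge_x (t : R) :
  circumradius R n * (cos (t + 2 * pi / n%:R) - cos t)
  = n%:R^-1 * - sin (t + pi / n%:R).
Proof.
have s0 : sin (pi / n%:R : R) != 0 by rewrite gt_eqF// sin_pi_gt0.
have -> : t + 2 * pi / n%:R = t + pi / n%:R + pi / n%:R by ring.
rewrite -[X in _ - cos X](addrK (pi / n%:R)) cosD cosB /circumradius.
by field; rewrite n0R.
Qed.

Lemma ngon_edge_y (t : R) :
  circumradius R n * (sin (t + 2 * pi / n%:R) - sin t)
  = n%:R^-1 * cos (t + pi / n%:R).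
Proof.
have s0 : sin (pi / n%:R : R) != 0 by rewrite gt_eqF// sin_pi_gt0.
have -> : t + 2 * pi / n%:R = t + pi / n%:R + pi / n%:R by ring.
rewrite -[X in _ - sin X](addrK (pi / n%:R)) sinD sinB /circumradius.
by field; rewrite n0R.
Qed.

Lemma ngon_xE (k : int) t (s := 2 * pi * (k%:~R / n%:R)) :
  k%:~R / n%:R <= t <= (k%:~R + 1) / n%:R ->
  ngon_x n t = circumradius R n * cos s + (t - k%:~R / n%:R) * - sin (s + pi / n%:R).
Proof.
(* At the right endpoint [node] has already jumped to the next vertex, so the formula of the
   previous edge has to be recovered from [ngon_edge_x]. *)
case/andP => t1; rewrite le_eqVlt => /orP[/eqP->|t2].
  have -> : ngon_x n ((k%:~R + 1) / n%:R) = circumradius R n * cos (s + 2 * pi / n%:R).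
    rewrite /ngon_x (node_eq (k := k + 1)) ?intrD ?ltr_pM2r ?invr_gt0 ?ltrDl//.
    by rewrite subrr mul0r addr0; congr (_ * cos _); rewrite /s; field.
  have := ngon_edge_x s; rewrite mulrBr => /eqP.
  rewrite subr_eq => /eqP ->; rewrite addrC; congr (_ + _ * _); by field.
by rewrite /ngon_x /ngon_dx (node_eq (k := k)).
Qed.

Lemma ngon_yE (k : int) t (s := 2 * pi * (k%:~R / n%:R)) :
  k%:~R / n%:R <= t <= (k%:~R + 1) / n%:R ->
  ngon_y n t = circumradius R n * sin s + (t - k%:~R / n%:R) * cos (s + pi / n%:R).
Proof.
case/andP => t1; rewrite le_eqVlt => /orP[/eqP->|t2].
  have -> : ngon_y n ((k%:~R + 1) / n%:R) = circumradius R n * sin (s + 2 * pi / n%:R).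
    rewrite /ngon_y (node_eq (k := k + 1)) ?intrD ?ltr_pM2r ?invr_gt0 ?ltrDl//.
    by rewrite subrr mul0r addr0; congr (_ * sin _); rewrite /s; field.
  have := ngon_edge_y s; rewrite mulrBr => /eqP.
  rewrite subr_eq => /eqP ->; rewrite addrC; congr (_ + _ * _); by field.
by rewrite /ngon_y /ngon_dy (node_eq (k := k)).
Qed.

(** Rotational symmetry: shifting the parameter by [k / n] rotates by the angle [s]. It gives the
    periodicity ([k = n]) and the chords between equally spaced points of any phase. *)
Lemma ngon_xD (k : int) t (s := 2 * pi * (k%:~R / n%:R)) :
  ngon_x n (t + k%:~R / n%:R) = cos s * ngon_x n t - sin s * ngon_y n t.
Proof.
rewrite /ngon_x /ngon_y /ngon_dx /ngon_dy nodeD.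
have -> : t + k%:~R / n%:R - (node n t + k%:~R / n%:R) = t - node n t by ring.
have -> : 2 * pi * (node n t + k%:~R / n%:R) + pi / n%:R
  = (2 * pi * node n t + pi / n%:R) + s by rewrite /s; ring.
have -> : 2 * pi * (node n t + k%:~R / n%:R) = 2 * pi * node n t + s.
  by rewrite /s; ring.
clearbody s; move: (2 * pi * node n t + pi / n%:R) (2 * pi * node n t) => A B.
by rewrite sinD !cosD; ring.
Qed.

Lemma ngon_yD (k : int) t (s := 2 * pi * (k%:~R / n%:R)) :
  ngon_y n (t + k%:~R / n%:R) = sin s * ngon_x n t + cos s * ngon_y n t.
Proof.
rewrite /ngon_x /ngon_y /ngon_dx /ngon_dy nodeD.
have -> : t + k%:~R / n%:R - (node n t + k%:~R / n%:R) = t - node n t by ring.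
have -> : 2 * pi * (node n t + k%:~R / n%:R) + pi / n%:R
  = (2 * pi * node n t + pi / n%:R) + s by rewrite /s; ring.
have -> : 2 * pi * (node n t + k%:~R / n%:R) = 2 * pi * node n t + s.
  by rewrite /s; ring.
clearbody s; move: (2 * pi * node n t + pi / n%:R) (2 * pi * node n t) => A B.
by rewrite sinD cosD; ring.
Qed.

Lemma ngon_x_periodic : periodic (ngon_x n : R -> R) 1.
Proof.
move=> t; have := ngon_xD n t; rewrite -pmulrn divff// => ->.
rewrite mulr1 -[2 * pi]add0r -[2 * pi]mulr1 -[1](_ : 1%:~R = 1)//.
by rewrite sin2intpi cos2intpi sin0 cos0; ring.
Qed.

Lemma ngon_y_periodic : periodic (ngon_y n : R -> R) 1.
Proof.
move=> t; have := ngon_yD n t; rewrite -pmulrn divff// => ->.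
rewrite mulr1 -[2 * pi]add0r -[2 * pi]mulr1 -[1](_ : 1%:~R = 1)//.
by rewrite sin2intpi cos2intpi sin0 cos0; ring.
Qed.

Variables (d : nat) (o u v : 'rV[R]_d).
Hypotheses (uu : dotp u u = 1) (vv : dotp v v = 1) (uv : dotp u v = 0).

Lemma sqr_enorm_orthonormal (x y : R) :
  enorm (x *: u + y *: v) ^+ 2 = x ^+ 2 + y ^+ 2.
Proof.
rewrite sqr_enorm !(dotpDl, dotpDr, dotpZl, dotpZr) (dotpC v u) uu vv uv.
by ring.
Qed.

Lemma ngon_affine (k : int) : exists a b : 'rV[R]_d, enorm b = 1 /\
  forall t, k%:~R / n%:R <= t <= (k%:~R + 1) / n%:R -> ngon n o u v t = a + t *: b.
Proof.
pose s : R := 2 * pi * (k%:~R / n%:R).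
pose b := - sin (s + pi / n%:R) *: u + cos (s + pi / n%:R) *: v.
exists (o + (circumradius R n * cos s *: u + circumradius R n * sin s *: v)
        - (k%:~R / n%:R) *: b), b; split.
  apply/eqP; rewrite -(@eqrXn2 _ 2)// ?enorm_ge0// sqr_enorm_orthonormal sqrrN.
  by rewrite addrC cos2Dsin2 expr1n.
move=> t tk; rewrite /ngon (ngon_xE tk) (ngon_yE tk) -/s /b.
by apply/rowP => c; rewrite !mxE; ring.
Qed.

Lemma ngon_periodic : periodic (ngon n o u v) 1.
Proof. by move=> t; rewrite /ngon ngon_x_periodic ngon_y_periodic. Qed.

Lemma ngon_chord (t : R) (i j : nat) :
  enorm (ngon n o u v (t + j%:R / n%:R) - ngon n o u v (t + i%:R / n%:R)) ^+ 2
  = (ngon_x n t ^+ 2 + ngon_y n t ^+ 2)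
    * (4 * sin ((j%:R - i%:R) * (pi / n%:R)) ^+ 2).
Proof.
set x := ngon_x n; set y := ngon_y n.
have -> : ngon n o u v (t + j%:R / n%:R) - ngon n o u v (t + i%:R / n%:R)
  = (x (t + j%:R / n%:R) - x (t + i%:R / n%:R)) *: u
    + (y (t + j%:R / n%:R) - y (t + i%:R / n%:R)) *: v.
  by apply/rowP => c; rewrite /ngon !mxE -/x -/y; ring.
rewrite sqr_enorm_orthonormal (pmulrn 1 j) (pmulrn 1 i) /x /y !ngon_xD !ngon_yD -/x -/y.
set a := 2 * pi * (j%:~R / n%:R); set b := 2 * pi * (i%:~R / n%:R).
have -> : 4 * sin ((j%:~R - i%:~R) * (pi / n%:R)) ^+ 2 = (1 - cos (a - b)) *+ 2.
  have -> : a - b = ((j%:~R - i%:~R) * (pi / n%:R)) *+ 2 by rewrite /a /b mulr2n; ring.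
  by rewrite cos_mulr2n sin2cos2; ring.
have [ha hb] := (cos2Dsin2 a, cos2Dsin2 b); rewrite cosB.
move: (cos a) (sin a) (cos b) (sin b) ha hb => ca sa cb sb ha hb.
transitivity ((x t ^+ 2 + y t ^+ 2)
  * ((ca ^+ 2 + sa ^+ 2) + (cb ^+ 2 + sb ^+ 2) - (ca * cb + sa * sb) *+ 2)).
  by ring.
by rewrite ha hb; ring.
Qed.

Lemma ngon_vertices : vertices n (ngon n o u v) (fun i => i%:R / n%:R).
Proof.
split=> [i|i|i|i].
- by rewrite ltr_pM2r ?invr_gt0// ltr_nat.
- by rewrite natrD mulrDl divff.
- by apply: cdist_inv => //; rewrite -natr1; field.
- have [a [b [_ ab]]] := ngon_affine i; exists a, b => t.
  by rewrite -natr1; exact: ab.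
Qed.

Lemma ngon_ae_unit_speed : {ae lebesgue_measure, forall t : R,
  derivable (ngon n o u v) t 1 /\ enorm (derive1 (ngon n o u v) t) = 1}.
Proof.
have cR : countable (range (fun k : int => k%:~R / n%:R : R)).
  exact: card_le_trans (card_image_le _ _) (countableP _).
exists (range (fun k : int => k%:~R / n%:R : R)); split.
- exact: countable_measurable.
- exact: countable_lebesgue_measure0.
move=> t /= h; apply: contrapT => nt; apply: h.
pose k := Num.floor (n%:R * t).
have kt : node n t = k%:~R / n%:R by [].
have [a [b [b1 ab]]] := ngon_affine k.
have tI : t \in `]k%:~R / n%:R, (k%:~R + 1) / n%:R[.
  rewrite in_itv/= mulrDl mul1r -kt node_gt andbT lt_neqAle node_le andbT.
  by apply/eqP => tk; apply: nt; exists k.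
have db : is_derive t 1 (ngon n o u v) b.
  apply: (@near_affine_is_derive _ _ _ a).
  apply: filterS (near_in_itvoo tI) => s; rewrite in_itv/= => /andP[s1 s2].
  by rewrite ab// !ltW.
by split => //; rewrite derive1E derive_val.
Qed.

Lemma ngon_equilateral : equilateral_polygons n (ngon n o u v).
Proof.
split; [exact: ngon_periodic|exact: ngon_ae_unit_speed|].
by exists (fun i => i%:R / n%:R); exact: ngon_vertices.
Qed.

(* The points given by [a] need not be corners a priori: the rotational symmetry
   gives the chords up to a common factor, which is fixed by the unit speed. *)
Lemma ngon_chord2 (a : nat -> R) (i j : nat) : vertices n (ngon n o u v) a ->
  enorm (ngon n o u v (a j) - ngon n o u v (a i)) ^+ 2 = chord2 R n j i.
Proof.
move=> va; have n0 := ltnW n1.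
have s0 : sin (pi / n%:R : R) != 0 by rewrite gt_eqF// sin_pi_gt0.
have := vertices_edge n0 va 0 ngon_ae_unit_speed.
rewrite (verticesE n0 va 1) (verticesE n0 va i) (verticesE n0 va j).
move=> /(congr1 (fun x => x ^+ 2)).
have := ngon_chord (a 0%N) 0 1; rewrite mul0r addr0 => ->.
rewrite subr0 mul1r => h.
rewrite ngon_chord /chord2.
rewrite -[X in X * _](mulfK (_ : 4 * sin (pi / n%:R) ^+ 2 != 0)); last first.
  by rewrite mulf_neq0// sqrf_eq0.
by rewrite h; field; rewrite s0 n0R.
Qed.

End Ngon.

(** * Minimizers are regular polygons *)

Lemma periodic1_int (R : realType) (V : zmodType) (f : R -> V) (k : int) (t : R) :
  periodic f 1 -> f (t + k%:~R) = f t.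
Proof.
move=> per; elim/int_rec: k t => [|k IH|k IH] t.
- by rewrite addr0.
- by rewrite -pmulrn -natr1 addrA per (pmulrn 1 k) IH.
- rewrite -per -addrA (_ : _ + 1 = (- k%:Z)%:~R) ?IH//.
  by rewrite !intrN -!pmulrn -natr1; ring.
Qed.

Lemma mobius_energy_at_fin (R : realType) (d n : nat) (p : R -> 'rV[R]_d)
    (a : nat -> R) :
  (forall i j : 'I_n, j != i -> enorm (p (a j) - p (a i)) != 0) ->
  mobius_energy_at n p a = (\sum_(i < n) \sum_(j < n | j != i)
     ((enorm (p (a j) - p (a i)) ^+ 2)^-1 - (cdist (a j) (a i) ^+ 2)^-1)
     * (cdist (a i.+1) (a i) * cdist (a j.+1) (a j)))%:E.
Proof.
move=> h; rewrite /mobius_energy_at -sumEFin; apply: eq_bigr => i _.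
rewrite -sumEFin; apply: eq_bigr => j ji.
by rewrite inver sqrf_eq0 (negbTE (h _ _ ji)).
Qed.

(** Two coinciding vertices give a term [+oo], since its factor is positive. No term is [-oo], so
    the whole sum is [+oo]. *)
Lemma mobius_energy_at_lty (R : realType) (d n : nat) (p : R -> 'rV[R]_d)
    (a : nat -> R) : (forall i, 0 < cdist (a i.+1) (a i)) ->
  (mobius_energy_at n p a < +oo)%E ->
  forall i j : 'I_n, j != i -> enorm (p (a j) - p (a i)) != 0.
Proof.
move=> cd fin i j ji; apply/eqP => pij; move: fin.
pose e (k l : 'I_n) : \bar R := ((((enorm (p (a l) - p (a k)) ^+ 2)%:E)^-1
  - ((cdist (a l) (a k) ^+ 2)^-1)%:E)
  * (cdist (a k.+1) (a k) * cdist (a l.+1) (a l))%:E)%E.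
have cc k l : (0%:E < (cdist (a k.+1) (a k) * cdist (a l.+1) (a l))%:E)%E.
  by rewrite lte_fin mulr_gt0.
have eNy k l : e k l != -oo%E.
  rewrite /e inver; case: ifP => _; last by rewrite -EFinB -EFinM.
  by rewrite addye// gt0_mulye.
suff -> : mobius_energy_at n p a = +oo%E by rewrite ltxx.
apply/eqP; rewrite [mobius_energy_at _ _ _](_ : _ = \sum_k \sum_(l | l != k) e k l)%E//.
rewrite esum_eqy => [|k _].
  apply/existsP; exists i => /=; rewrite esum_eqy => [|l _]; last exact: eNy.
  apply/existsP; exists j; rewrite unfold_in/= ji/= /e pij expr0n/= inve0.
  by rewrite addye// gt0_mulye.
apply/eqP => /esum_eqNyP[l [_ _ lk]].
by have := eNy k l; rewrite lk.
Qed.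

Lemma affine_zero (R : fieldType) (V : lmodType R) (v w : V) (s s' t : R) :
  s != s' -> v + s *: w = 0 -> v + s' *: w = 0 -> v + t *: w = 0.
Proof.
move=> ss' vs vs'.
have : (s - s') *: w = 0.
  have -> : (s - s') *: w = (v + s *: w) - (v + s' *: w).
    by rewrite opprD addrACA subrr add0r scalerBl.
  by rewrite vs vs' subrr.
move=> /eqP; rewrite scaler_eq0 subr_eq0 (negbTE ss') /= => /eqP w0.
by move: vs; rewrite w0 !scaler0.
Qed.

(** On each arc the difference of the two curves is affine and vanishes at both endpoints. By
    periodicity it is enough to treat the arcs of the turn that starts at [a 0]. *)
Lemma regular_vertices_ngon (R : realType) (d n : nat) (p : R -> 'rV[R]_d)
    (a : nat -> R) (o u v : 'rV[R]_d) : (1 < n)%N ->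
  periodic p 1 -> vertices n p a ->
  (forall i, (i < n)%N -> p (a i) = o +
    ((circumradius R n * cos (vertex_angle R n i)) *: u
     + (circumradius R n * sin (vertex_angle R n i)) *: v)) ->
  forall t, p t = ngon n o u v (t - a 0%N).
Proof.
move=> n1 per va pE.
have n0 := ltnW n1.
have n0R : n%:R != 0 :> R by rewrite pnatr_eq0 -lt0n.
have n_gt0 : 0 < n%:R :> R by rewrite ltr0n.
have qper := ngon_periodic n1 o u v.
(* The case [i = n] is included because the last arc ends at [a n], one turn after [a 0]. *)
have pq i : (i <= n)%N -> p (a i) = ngon n o u v (i%:R / n%:R).
  have aux j : (j < n)%N -> p (a j) = ngon n o u v (j%:R / n%:R).
    pose s : R := j%:~R; have jI : s / n%:R <= s / n%:R <= (s + 1) / n%:R.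
      by rewrite lexx ler_pM2r ?invr_gt0// lerDl ler01.
    move=> jn; rewrite pE// /ngon (pmulrn 1 j) (ngon_xE n1 jI) (ngon_yE n1 jI).
    rewrite subrr !mul0r !addr0 -pmulrn; congr (_ + (_ *: _ + _ *: _)).
      by congr (_ * cos _); rewrite /vertex_angle; ring.
    by congr (_ * sin _); rewrite /vertex_angle; ring.
  rewrite leq_eqVlt => /orP[/eqP->|]; last exact: aux.
  case: (va) => _ pera _ _; rewrite -[n in LHS]add0n pera per aux//.
  by rewrite -qper divff// mul0r add0r.
move=> t; pose k := Num.floor (t - a 0%N).
have -> : t = t - k%:~R + k%:~R by rewrite subrK.
rewrite periodic1_int// -addrA [k%:~R - _]addrC addrA periodic1_int//.
have : 0 <= t - k%:~R - a 0%N < 1.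
  by have := floor_itv (t - a 0%N); rewrite -/k intrD => /andP[h1 h2];
  apply/andP; split; lra.
move: (t - k%:~R) => {k}{}t /andP[t0 t1].
have [i iE] : exists i : nat, Num.floor (n%:R * (t - a 0%N)) = i%:Z.
  have : 0 <= Num.floor (n%:R * (t - a 0%N)).
    by rewrite floor_ge0 mulr_ge0// ltW.
  by case: Num.floor => // i _; exists i.
have := floor_itv (n%:R * (t - a 0%N)); rewrite iE intrD -pmulrn => /andP[i1 i2].
have lin : (i < n)%N.
  by rewrite -(ltr_nat R); apply: (le_lt_trans i1); rewrite gtr_pMr.
have ti : a i <= t <= a i.+1.
  rewrite (verticesE n0 va i) (verticesE n0 va i.+1) -natr1.
  rewrite -lerBrDl ler_pdivrMr// -lerBlDl ler_pdivlMr// mulrC i1/=.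
  by rewrite ltW.
case: (va) => inc _ _ /(_ i)[x [y xy]].
have qE s : a i <= s <= a i.+1 -> (i%:~R / n%:R <= s - a 0%N <= (i%:~R + 1) / n%:R).
  rewrite (verticesE n0 va i) (verticesE n0 va i.+1) -natr1 pmulrn.
  by move=> /andP[s1 s2]; apply/andP; split; lra.
pose z s := p s - ngon n o u v (s - a 0%N).
have [A [B zE]] : exists A B, forall s, a i <= s <= a i.+1 -> z s = A + s *: B.
  pose m := 2 * pi * (i%:~R / n%:R) : R.
  pose e := - sin (m + pi / n%:R) *: u + cos (m + pi / n%:R) *: v.
  exists (x - (o + (circumradius R n * cos m *: u + circumradius R n * sin m *: v)
           - (a 0%N + i%:~R / n%:R) *: e)), (y - e) => s si.
  rewrite /z xy// /ngon (ngon_xE n1 (qE _ si)) (ngon_yE n1 (qE _ si)) -/m /e.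
  by apply/rowP => c; rewrite !mxE; ring.
have zv j : (j <= n)%N -> z (a j) = 0.
  move=> jn; rewrite /z pq// (verticesE n0 va j).
  by rewrite (_ : a 0%N + _ - _ = j%:R / n%:R) ?subrr//; ring.
apply/eqP; rewrite -subr_eq0 -/(z t) zE//; apply/eqP.
have h1 := zv i (ltnW lin); rewrite zE ?lexx ?ltW// in h1.
have h2 := zv i.+1 lin; rewrite zE ?lexx ?ltW// in h2.
by apply: affine_zero h1 h2; rewrite lt_eqF.
Qed.

Lemma exists_orthonormal (R : realType) (d : nat) : (2 <= d)%N ->
  exists u v : 'rV[R]_d, [/\ dotp u u = 1, dotp v v = 1 & dotp u v = 0].
Proof.
move=> d2; pose i0 := Ordinal (ltnW d2); pose i1 := Ordinal d2.
have dE (i j : 'I_d) : dotp (delta_mx 0 i) (delta_mx 0 j) = (i == j)%:R :> R.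
  transitivity (\sum_(k < d) (k == i)%:R * (k == j)%:R : R).
    by apply: eq_bigr => k _; rewrite !mxE.
  rewrite (bigD1 i)//= eqxx mul1r big1 ?addr0// => k /negbTE->.
  by rewrite mul0r.
by exists (delta_mx 0 i0), (delta_mx 0 i1); rewrite !dE !eqxx.
Qed.

Lemma minimizer_ngon (R : realType) (d n : nat) (p : R -> 'rV[R]_d) :
  (2 <= d)%N -> (3 <= n)%N -> equilateral_polygons n p ->
  mobius_energy n p
    = ereal_inf [set mobius_energy n q | q in @equilateral_polygons R d n] ->
  exists (a : R) (o u v : 'rV[R]_d),
    [/\ dotp u u = 1, dotp v v = 1, dotp u v = 0
      & forall t, p t = ngon n o u v (t - a)].
Proof.
move=> d2; case: n => [|[|[|N]]]// _; set n := N.+3.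
have n1 : (1 < n)%N by []. have n0 := ltnW n1.
have n_gt0 : 0 < n%:R :> R by rewrite ltr0n.
move=> [per ae exv] pmin.
have [e0 [e1 [e00 e11 e01]]] := exists_orthonormal R d2.
pose q := ngon n 0 e0 e1.
have qP : equilateral_polygons n q by exact: ngon_equilateral.
(* These are the vertices chosen in the definition of [mobius_energy]. Nothing is known about them,
   or about those of [q], beyond [vertices]. *)
pose a := get [set a | vertices n p a].
have va : vertices n p a := getPex exv.
pose b := get [set a | vertices n q a].
have vb : vertices n q b by case: qP => _ _ exb; exact: getPex exb.
have le : (mobius_energy_at n p a <= mobius_energy_at n q b)%E.
  rewrite -/(mobius_energy n p) -/(mobius_energy n q) pmin.
  by apply: ereal_inf_lbound; exists q.
have cd (s : nat -> R) (f : R -> 'rV[R]_d) : vertices n f s ->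
    forall i, cdist (s i.+1) (s i) = n%:R^-1.
  by case.
have cda i : 0 < cdist (a i.+1) (a i) by rewrite (cd _ _ va) invr_gt0.
have qD (i j : 'I_n) : enorm (q (b j) - q (b i)) ^+ 2 = chord2 R n j i.
  exact: ngon_chord2.
have q0 (i j : 'I_n) : j != i -> enorm (q (b j) - q (b i)) != 0.
  by move=> ji; rewrite -sqrf_eq0 qD gt_eqF// chord2_gt0.
rewrite (mobius_energy_at_fin q0) in le.
(* The regular polygon has finite energy, hence so does [p], and its vertices are distinct. *)
have p0 := mobius_energy_at_lty cda (le_lt_trans le (ltry _)).
rewrite (mobius_energy_at_fin p0) lee_fin in le.
(* Both sequences advance by [1 / n], so the subtracted terms of the two energies have the same sum
   [K] and cancel. *)
have cab (i j : 'I_n) : cdist (b j) (b i) = cdist (a j) (a i).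
  apply: cdistE; rewrite (verticesE n0 va i) (verticesE n0 va j).
  by rewrite (verticesE n0 vb i) (verticesE n0 vb j); ring.
pose K := \sum_(i < n) \sum_(j < n | j != i) (cdist (a j) (a i) ^+ 2)^-1.
have split_sum (D : 'I_n -> 'I_n -> R) (s : nat -> R) (f : R -> 'rV[R]_d) :
  vertices n f s ->
  (forall i j : 'I_n, cdist (s j) (s i) = cdist (a j) (a i)) ->
  \sum_(i < n) \sum_(j < n | j != i) (D i j - (cdist (s j) (s i) ^+ 2)^-1)
     * (cdist (s i.+1) (s i) * cdist (s j.+1) (s j))
  = (\sum_(i < n) \sum_(j < n | j != i) D i j - K) / n%:R ^+ 2.
  move=> vs cs; rewrite /K -sumrB mulr_suml; apply: eq_bigr => i _.
  rewrite -sumrB mulr_suml; apply: eq_bigr => j _.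
  by rewrite cs !(cd _ _ vs) -expr2 exprVn.
rewrite (split_sum _ _ _ va)// (split_sum _ _ _ vb)// in le.
rewrite ler_pM2r ?invr_gt0 ?exprn_gt0// lerD2r in le.
(* Addition in ['I_n] wraps around, whereas [a] goes on to the next turn. *)
have xE i : p (a (i %% n)%N) = p (a i).
  rewrite [in RHS](divn_eq i n) (verticesE n0 va (_ + _)) (verticesE n0 va (_ %% _)).
  rewrite natrD mulrDl natrM mulfK ?gt_eqF// addrCA addrC (pmulrn 1 (_ %/ _)).
  by rewrite periodic1_int.
have dist := @energy_rigidity R d N.+1 (fun i => p (a i)) _ (fun i j => p0 j i) _.
have {}dist : forall i j : 'I_n, enorm (p (a j) - p (a i)) ^+ 2 = chord2 R n j i.
  apply: dist.
    by move=> i; rewrite -(vertices_edge n0 va i ae) -(xE i.+1) /= addn1.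
  by move: le; under [leRHS]eq_bigr do under eq_bigr do rewrite qD.
have [c [u [v [uu vv uv pE]]]] := regular_polygon_of_dist dist.
exists (a 0%N), c, u, v; split => //.
by apply: regular_vertices_ngon => // i lin; exact: (pE (Ordinal lin)).
Qed.

(** * Weak derivatives by pieces *)

Lemma enorm_le_sum (R : realType) (d : nat) (v : 'rV[R]_d) (c : R) :
  (forall i, `|v 0 i| <= c) -> enorm v <= d%:R * c.
Proof.
case: d v => [|d] v vc.
  by rewrite /enorm /dotp big_ord0 sqrtr0 mul0r.
have c0 : 0 <= c by apply: le_trans (vc 0).
rewrite /enorm -(ger0_norm (mulr_ge0 (ler0n _ _) c0)) -sqrtr_sqr ler_wsqrtr//.
apply: (@le_trans _ _ (\sum_(i < d.+1) c ^+ 2)).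
  apply: ler_sum => i _; rewrite -expr2 -[leLHS]real_normK ?num_real//.
  by rewrite lerXn2r ?nnegrE.
rewrite sumr_const card_ord -[leLHS]mulr_natl exprMn ler_wpM2r ?sqr_ge0//.
by rewrite expr2 ler_peMl// ler1n.
Qed.

Lemma norm_coord_le_enorm (R : realType) (d : nat) (v : 'rV[R]_d) i :
  `|v 0 i| <= enorm v.
Proof.
rewrite -sqrtr_sqr ler_wsqrtr// /dotp (bigD1 i)//= -expr2 lerDl.
by apply: sumr_ge0 => j _; rewrite -expr2 sqr_ge0.
Qed.

(** The definition of [Lnorm] at exponent [+oo] tests whether the whole space has positive
    measure. *)
Lemma lebesgue_measureT_gt0 (R : realType) :
  (0 < lebesgue_measure [set: R])%E.
Proof.
apply: (@lt_le_trans _ _ (lebesgue_measure (`[0, 1]%classic : set R))).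
  by rewrite lebesgue_measure_itv/= lte_fin ltr01 oppr0 adde0 lte_fin.
by apply: le_measure; rewrite ?inE.
Qed.

Lemma Linfty_norm_le (R : realType) (d : nat) (f : R -> 'rV[R]_d) (c : R) :
  (forall t, enorm (f t) <= c) -> (Linfty_norm f <= c%:E)%E.
Proof.
move=> fc; rewrite /Linfty_norm unlock lebesgue_measureT_gt0.
apply/ess_supP/nearW => t /=; rewrite lee_fin ger0_norm//.
exact: sqrtr_ge0.
Qed.

(** One such parameter is enough to locate the center of a polygon of known size. *)
Lemma Linfty_norm_witness (R : realType) (d : nat) (f : R -> 'rV[R]_d) (c : R) :
  (Linfty_norm f <= c%:E)%E -> exists t, enorm (f t) <= c.
Proof.
rewrite /Linfty_norm unlock lebesgue_measureT_gt0 => /ess_supP[B [mB B0 sB]].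
apply: contrapT => h.
have BT : B = setT.
  apply/seteqP; split=> // t _; apply: (sB t) => /= ft; apply: h; exists t.
  by move: ft; rewrite lee_fin; apply: le_trans; exact: ler_norm.
by have := lebesgue_measureT_gt0 R; rewrite -BT B0 ltxx.
Qed.

Section IntegrationByPieces.
Variables (R : realType) (f g phi : R -> R) (C : R).
Hypotheses (mf : measurable_fun setT f) (mg : measurable_fun setT g).
Hypotheses (fC : forall t, `|f t| <= C) (gC : forall t, `|g t| <= C).
Hypothesis phiC : forall k t, derivable (derive1n k phi) t 1.
Notation mu := lebesgue_measure.

Let dphi (t : R) : derivable phi t 1 := @phiC 0%N t.

Let cphi : continuous phi.
Proof. by move=> t; apply/differentiable_continuous/derivable1_diffP/dphi. Qed.

Let cphi' : continuous (derive1 phi).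
Proof.
by move=> t; apply/differentiable_continuous/derivable1_diffP; exact: (@phiC 1%N t).
Qed.

Lemma bounded_mul_integrable (h k : R -> R) : measurable_fun setT h ->
  (forall t, `|h t| <= C) -> continuous k ->
  mu.-integrable `[0, 1] (EFin \o (fun t => h t * k t)).
Proof.
move=> mh hC ck; have : mu.-integrable `[0, 1] (EFin \o k).
  apply: continuous_compact_integrable; first exact: segment_compact.
  exact: continuous_subspaceT.
apply: integrableMr => //; first exact: measurable_funTS.
exists C; split; first exact: num_real.
by move=> M CM t _ /=; rewrite (le_trans (hC t))// ltW.
Qed.

Let h (t : R) : R := f t * derive1 phi t + g t * phi t.

Let ih : mu.-integrable `[0, 1] (EFin \o h).
Proof.
rewrite (_ : EFin \o h = (EFin \o (fun t => f t * derive1 phi t))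
  \+ (EFin \o (fun t => g t * phi t)))//.
by apply: integrableD => //; exact: bounded_mul_integrable.
Qed.

(** [F] and [G] continue the piece to the whole line, so that the fundamental theorem of calculus
    applies to [F * phi]. The velocity [g] is prescribed only inside the piece, as it jumps at
    corners. *)
Lemma piece_integral (F G : R -> R) (x y : R) : 0 <= x -> x < y -> y <= 1 ->
  (forall t : R, is_derive t 1 F (G t)) -> continuous G ->
  (forall t, x <= t <= y -> f t = F t) -> (forall t, x < t < y -> g t = G t) ->
  \int[mu]_(t in `[x, y]) h t = f y * phi y - f x * phi x.
Proof.
move=> x0 xy y1 dF cG fF gG.
have sub (b c : bool) : [set` Interval (BSide b x) (BSide c y)] `<=` `[0, 1]%classic.
  by apply: subset_itv; case: b; case: c; rewrite bnd_simp// ltW.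
have cF : continuous F.
  move=> t; apply/differentiable_continuous/derivable1_diffP.
  by have [] := dF t.
pose H t := F t * derive1 phi t + G t * phi t.
have cH : continuous H.
  by move=> t; apply: cvgD; apply: cvgM;
    [exact: cF|exact: cphi'|exact: cG|exact: cphi].
have dFphi (t : R) : is_derive t 1 (F * phi) (H t).
  have dp : is_derive t 1 phi (derive1 phi t).
    by rewrite derive1E; apply: DeriveDef => //; exact: dphi.
  by apply: is_derive_eq; rewrite /H addrC [G t * _]mulrC addrC.
have cFphi : continuous (F * phi).
  by move=> t; apply: cvgM; [exact: cF|exact: cphi].
have iH (b c : bool) :
    mu.-integrable [set` Interval (BSide b x) (BSide c y)] (EFin \o H).
  have iH : mu.-integrable `[x, y] (EFin \o H).
    apply: continuous_compact_integrable; first exact: segment_compact.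
    exact: continuous_subspaceT.
  apply: integrableS iH => //.
  by apply: subset_itv; case: b; case: c; rewrite bnd_simp.
have ih' (b c : bool) :
    mu.-integrable [set` Interval (BSide b x) (BSide c y)] (EFin \o h).
  exact: integrableS ih.
have -> : \int[mu]_(t in `[x, y]) h t = \int[mu]_(t in `[x, y]) H t.
  (* The endpoints, where [g] and [G] may differ, are dropped from the integral. *)
  rewrite -!Rintegral_itv_obnd_cbnd// -!Rintegral_itv_bndo_bndc//.
  apply: eq_Rintegral => t; rewrite inE/= in_itv/= => /andP[xt ty].
  by rewrite /h /H fF ?gG ?xt// !ltW.
rewrite /Rintegral (@continuous_FTC2 _ H (F * phi)) //.
- by rewrite -EFinB/= !fF ?lexx ?ltW.
- exact: continuous_subspaceT.
- split => [t _||].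
  + by have [] := dFphi t.
  + by apply: cvg_at_right_filter; exact: cFphi.
  + by apply: cvg_at_left_filter; exact: cFphi.
- by move=> t _; rewrite derive1E; have [_ ->] := dFphi t.
Qed.

(** The boundary terms of the pieces telescope, and those at 0 and 1 cancel by the last hypothesis.
    Empty pieces are allowed so that a subdivision can be clamped to [[0, 1]]. *)
Lemma integral_by_pieces (s : nat -> R) (m : nat) :
  s 0%N = 0 -> s m = 1 -> (forall k, s k <= s k.+1) ->
  (forall k, s k < s k.+1 -> exists F G : R -> R,
    [/\ forall t : R, is_derive t 1 F (G t), continuous G,
      forall t, s k <= t <= s k.+1 -> f t = F t
    & forall t, s k < t < s k.+1 -> g t = G t]) ->
  f 0 * phi 0 = f 1 * phi 1 ->
  \int[mu]_(t in `[0, 1]) (f t * derive1 phi t)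
    = - \int[mu]_(t in `[0, 1]) (g t * phi t).
Proof.
move=> s0 sm sinc pieces per.
have smono j k : (j <= k)%N -> s j <= s k.
  elim: k => [|k IH]; first by rewrite leqn0 => /eqP ->.
  by rewrite leq_eqVlt => /orP[/eqP->//|/IH]/le_trans; apply.
suff : forall k, (k <= m)%N ->
    \int[mu]_(t in `[0, s k]) h t = f (s k) * phi (s k) - f 0 * phi 0.
  move=> /(_ m (leqnn m)); rewrite sm per subrr => H0.
  apply/eqP; rewrite -subr_eq0 opprK -RintegralD//; last 2 first.
  - exact: bounded_mul_integrable.
  - exact: bounded_mul_integrable.
  by rewrite H0.
elim=> [_|k IH km].
  by rewrite s0 subrr set_itv1 Rintegral_set1.
have := sinc k; rewrite le_eqVlt => /orP[/eqP <-|sk]; first exact/IH/ltnW.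
have k0 : 0 <= s k by rewrite -s0 smono.
have k1 : s k.+1 <= 1 by rewrite -sm smono.
have [F [G [dF cG fF gG]]] := pieces k sk.
have := piece_integral k0 sk k1 dF cG fF gG.
have ik : mu.-integrable `[0, s k.+1] (EFin \o h).
  by apply: integrableS ih => //; apply: subset_itv; rewrite bnd_simp.
have := @Rintegral_itvB _ h (BLeft 0) (BRight (s k.+1)) (s k) ik.
rewrite !bnd_simp => /(_ k0 (ltW sk)).
rewrite (Rintegral_itv_obnd_cbnd (r := s k)); last first.
  by apply: integrableS ik => //; apply: subset_itv; rewrite bnd_simp.
by rewrite IH ?(ltnW km)// => + piece; rewrite piece; lra.
Qed.

End IntegrationByPieces.

Lemma W1infty_derivative_of_pieces (R : realType) (d : nat)
    (f g : R -> 'rV[R]_d) (C : R) (s : nat -> R) (m : nat) :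
  periodic f 1 -> periodic g 1 ->
  (forall i, measurable_fun setT (fun t => f t 0 i)) ->
  (forall i, measurable_fun setT (fun t => g t 0 i)) ->
  (forall t i, `|f t 0 i| <= C) -> (forall t i, `|g t 0 i| <= C) ->
  s 0%N = 0 -> s m = 1 -> (forall k, s k <= s k.+1) ->
  (forall k i, s k < s k.+1 -> exists F G : R -> R,
    [/\ forall t : R, is_derive t 1 F (G t), continuous G,
      forall t, s k <= t <= s k.+1 -> f t 0 i = F t
    & forall t, s k < t < s k.+1 -> g t 0 i = G t]) ->
  W1infty_derivative f g.
Proof.
move=> pf pg mf mg fC gC s0 sm sinc pieces.
have bnd (w : R -> 'rV[R]_d) : (forall t i, `|w t 0 i| <= C) ->
    (Linfty_norm w < +oo)%E.
  move=> wC; apply: le_lt_trans (ltry (d%:R * C)).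
  by apply: Linfty_norm_le => t; exact: enorm_le_sum.
split; [split => //; exact: bnd|split => //; exact: bnd|].
move=> phi [pphi dphi] i; apply: (@integral_by_pieces _ _ _ _ C _ _ _ _ _ s m) => //.
- by move=> k /pieces; apply.
- by rewrite -[1]add0r pf pphi.
Qed.

(** * Circles and regular polygons as Sobolev curves *)

Definition circle (R : realType) (d : nat) (o u v : 'rV[R]_d) (t : R) : 'rV[R]_d :=
  o + (2 * pi)^-1 *: (cos (2 * pi * t) *: u + sin (2 * pi * t) *: v).

Definition circle_velocity (R : realType) (d : nat) (u v : 'rV[R]_d) (t : R) :
  'rV[R]_d := - sin (2 * pi * t) *: u + cos (2 * pi * t) *: v.

Definition ngon_velocity (R : realType) (d n : nat) (u v : 'rV[R]_d) (t : R) :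
  'rV[R]_d := ngon_dx n t *: u + ngon_dy n t *: v.

Lemma is_derive_affine (R : realType) (b c t : R) :
  is_derive t 1 (fun s => b + s * c) c.
Proof.
rewrite (_ : (fun s => _) = cst b + c *: (id : R -> R)).
  by apply: is_derive_eq; rewrite add0r /GRing.scale/= mulr1.
by apply/funext => s /=; rewrite mulrC.
Qed.

Lemma is_derive_comb2 (R : realType) (f g : R -> R) (b c e t f' g' : R) :
  is_derive t 1 f f' -> is_derive t 1 g g' ->
  is_derive t 1 (fun s => b + (f s * c + g s * e)) (f' * c + g' * e).
Proof.
move=> df dg.
have h := is_deriveD (is_derive_cst b t (1 : R))
  (is_deriveD (is_deriveZ c df) (is_deriveZ e dg)).
rewrite (_ : (fun s => _) = cst b + ((c \*: f) + (e \*: g))).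
  by apply: is_derive_eq; rewrite add0r /GRing.scale/= [c * _]mulrC [e * _]mulrC.
by apply/funext => s /=; rewrite [f s * c]mulrC [g s * e]mulrC.
Qed.

Lemma norm_coord_le1 (R : realType) (d : nat) (u : 'rV[R]_d) i :
  dotp u u = 1 -> `|u 0 i| <= 1.
Proof.
move=> u1; apply: le_trans (norm_coord_le_enorm u i) _.
by rewrite /enorm u1 sqrtr1.
Qed.

Lemma circle_coordE (R : realType) (d : nat) (o u v : 'rV[R]_d) (t : R) i :
  circle o u v t 0 i = o 0 i + (2 * pi)^-1 * (cos (2 * pi * t) * u 0 i
    + sin (2 * pi * t) * v 0 i).
Proof. by rewrite /circle !mxE. Qed.

Lemma circle_velocity_coordE (R : realType) (d : nat) (u v : 'rV[R]_d) (t : R) i :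
  circle_velocity u v t 0 i = - sin (2 * pi * t) * u 0 i + cos (2 * pi * t) * v 0 i.
Proof. by rewrite /circle_velocity !mxE. Qed.

Lemma ngon_coordE (R : realType) (d n : nat) (o u v : 'rV[R]_d) (t : R) i :
  ngon n o u v t 0 i = o 0 i + (ngon_x n t * u 0 i + ngon_y n t * v 0 i).
Proof. by rewrite /ngon !mxE. Qed.

Lemma ngon_velocity_coordE (R : realType) (d n : nat) (u v : 'rV[R]_d) (t : R) i :
  ngon_velocity n u v t 0 i = ngon_dx n t * u 0 i + ngon_dy n t * v 0 i.
Proof. by rewrite /ngon_velocity !mxE. Qed.

Lemma norm_sinB_le (R : realType) (x y : R) : `|sin x - sin y| <= `|x - y|.
Proof.
wlog xy : x y / y <= x => [hw|].
  have /orP[h|h] := le_total y x; first exact: hw.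
  by rewrite distrC [leRHS]distrC; exact: hw.
have [|c _ ->] := @MVT_segment R sin cos y x xy.
  exact/continuous_subspaceT/continuous_sin.
by rewrite normrM ler_piMl// cos_max.
Qed.

Lemma norm_cosB_le (R : realType) (x y : R) : `|cos x - cos y| <= `|x - y|.
Proof.
have := norm_sinB_le (x + pi / 2) (y + pi / 2).
by rewrite !sinDpihalf opprD addrACA subrr addr0.
Qed.

Lemma norm_comb2_le (R : realType) (x y u v : R) : `|u| <= 1 -> `|v| <= 1 ->
  `|x * u + y * v| <= `|x| + `|y|.
Proof.
move=> u1 v1; apply: le_trans (ler_normD _ _) _; rewrite !normrM lerD//.
  by rewrite ler_piMr.
by rewrite ler_piMr.
Qed.

Lemma twopi_gt1 (R : realType) : 1 < 2 * pi :> R.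
Proof. by have := pi_ge2 R; lra. Qed.

Lemma circle_W1infty (R : realType) (d : nat) (o u v : 'rV[R]_d) (a : R) :
  dotp u u = 1 -> dotp v v = 1 ->
  W1infty_derivative (fun t => circle o u v (t - a))
                     (fun t => circle_velocity u v (t - a)).
Proof.
move=> uu vv; have p1 := twopi_gt1 R; have p0 : 0 < 2 * pi :> R by lra.
pose w (t : R) := 2 * pi * (t - a).
have dw (t : R) : is_derive t 1 w (2 * pi).
  have -> : w = (fun s => - (2 * pi * a) + s * (2 * pi)).
    by apply/funext => s; rewrite /w; ring.
  exact: is_derive_affine.
have dcos (t : R) : is_derive t 1 (cos \o w) (- sin (w t) * (2 * pi)).
  exact: is_derive1_comp.
have dsin (t : R) : is_derive t 1 (sin \o w) (cos (w t) * (2 * pi)).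
  exact: is_derive1_comp.
have cw : continuous w.
  by move=> t; apply/differentiable_continuous/derivable1_diffP; have [] := dw t.
have ccos : continuous (fun t => cos (w t)).
  by move=> t; apply: continuous_comp; [exact: cw|exact: continuous_cos].
have csin : continuous (fun t => sin (w t)).
  by move=> t; apply: continuous_comp; [exact: cw|exact: continuous_sin].
have cf (b c e : R) : continuous (fun t => b + (cos (w t) * c + sin (w t) * e)).
  move=> t; apply: cvgD; first exact: cvg_cst.
  apply: cvgD; apply: cvgM; try exact: cvg_cst; [exact: ccos|exact: csin].
have cg (c e : R) : continuous (fun t => - sin (w t) * c + cos (w t) * e).
  move=> t; apply: cvgD; apply: cvgM; try exact: cvg_cst; last exact: ccos.
  by apply: cvgN; exact: csin.
have wper (t : R) : w (t + 1) = w t + pi *+ 2 by rewrite /w mulr2n; ring.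
have fE i : (fun t => circle o u v (t - a) 0 i)
    = (fun t => o 0 i + (cos (w t) * ((2 * pi)^-1 * u 0 i)
                        + sin (w t) * ((2 * pi)^-1 * v 0 i))).
  by apply/funext => t; rewrite circle_coordE; congr (_ + _); rewrite -/(w t); ring.
have gE i : (fun t => circle_velocity u v (t - a) 0 i)
    = (fun t => - sin (w t) * u 0 i + cos (w t) * v 0 i).
  by apply/funext => t; rewrite circle_velocity_coordE.
have inv1 : (2 * pi)^-1 <= 1 :> R by rewrite invf_le1// ltW.
have inv0 : 0 < (2 * pi)^-1 :> R by rewrite invr_gt0.
(* A single piece [[0, 1]], with one constant that bounds both the circle and its velocity. *)
apply: (@W1infty_derivative_of_pieces _ _ _ _ (enorm o + 2)
  (fun k => if k is 0%N then 0 else 1) 1).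
- by move=> t; rewrite /circle -/(w (t + 1)) -/(w t) wper cosD2pi sinD2pi.
- by move=> t; rewrite /circle_velocity -/(w (t + 1)) -/(w t) wper cosD2pi sinD2pi.
- by move=> i; rewrite fE; exact: continuous_measurable_fun.
- by move=> i; rewrite gE; exact: continuous_measurable_fun.
- move=> t i; rewrite circle_coordE; apply: le_trans (ler_normD _ _) _.
  apply: lerD; first exact: norm_coord_le_enorm.
  rewrite normrM gtr0_norm//.
  have := norm_comb2_le (cos (w t)) (sin (w t)) (norm_coord_le1 i uu)
    (norm_coord_le1 i vv).
  rewrite -/(w t) => h; apply: (@le_trans _ _ (1 * 2)); last by rewrite mul1r.
  apply: ler_pM => //; first exact: ltW.
  by apply: (le_trans h); have := cos_max (w t); have := sin_max (w t); lra.
- move=> t i; rewrite circle_velocity_coordE -/(w t).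
  apply: (le_trans (norm_comb2_le _ _ (norm_coord_le1 i uu) (norm_coord_le1 i vv))).
  rewrite normrN; have := cos_max (w t); have := sin_max (w t).
  by have := enorm_ge0 o; lra.
- by [].
- by [].
- by case.
- move=> k i _; exists (fun t => circle o u v (t - a) 0 i),
    (fun t => circle_velocity u v (t - a) 0 i); split => //.
    move=> t; rewrite fE circle_velocity_coordE -/(w t).
    apply: is_derive_eq (is_derive_comb2 _ _ _ (dcos t) (dsin t)) _.
    move: p0; move: (2 * pi) => P P0; field; exact: lt0r_neq0.
  by rewrite gE; exact: cg.
Qed.

Section NgonRegularity.
Variables (R : realType) (d n : nat).
Hypothesis n1 : (1 < n)%N.

Let n_gt0 : 0 < n%:R :> R.
Proof. by rewrite ltr0n ltnW. Qed.

Lemma measurable_node : measurable_fun setT (node n : R -> R).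
Proof.
apply: nondecreasing_measurable => // s t st; rewrite /node ler_pM2r ?invr_gt0//.
by rewrite ler_int le_floor// ler_pM2l.
Qed.

Lemma measurable_ngon_dx : measurable_fun setT (ngon_dx n : R -> R).
Proof.
apply: measurable_funN; apply: measurableT_comp.
  by apply: continuous_measurable_fun; exact: continuous_sin.
apply: measurable_funD => //; apply: measurable_funM => //.
exact: measurable_node.
Qed.

Lemma measurable_ngon_dy : measurable_fun setT (ngon_dy n : R -> R).
Proof.
apply: measurableT_comp; first by apply: continuous_measurable_fun; exact: continuous_cos.
apply: measurable_funD => //; apply: measurable_funM => //.
exact: measurable_node.
Qed.

Lemma measurable_ngon_x : measurable_fun setT (ngon_x n : R -> R).
Proof.
apply: measurable_funD.
  apply: measurable_funM => //; apply: measurableT_comp.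
    by apply: continuous_measurable_fun; exact: continuous_cos.
  by apply: measurable_funM => //; exact: measurable_node.
apply: measurable_funM; last exact: measurable_ngon_dx.
by apply: measurable_funB => //; exact: measurable_node.
Qed.

Lemma measurable_ngon_y : measurable_fun setT (ngon_y n : R -> R).
Proof.
apply: measurable_funD.
  apply: measurable_funM => //; apply: measurableT_comp.
    by apply: continuous_measurable_fun; exact: continuous_sin.
  by apply: measurable_funM => //; exact: measurable_node.
apply: measurable_funM; last exact: measurable_ngon_dy.
by apply: measurable_funB => //; exact: measurable_node.
Qed.

Lemma norm_ngon_dx_le1 (t : R) : `|ngon_dx n t| <= 1.
Proof. by rewrite normrN sin_max. Qed.

Lemma norm_ngon_dy_le1 (t : R) : `|ngon_dy n t| <= 1.
Proof. exact: cos_max. Qed.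

Lemma norm_node_le (t : R) : `|t - node n t| <= n%:R^-1.
Proof.
have := node_le n1 t; have := node_gt n1 t; rewrite ler_norml => ? ?.
by apply/andP; split; lra.
Qed.

Lemma norm_ngon_x_le (t : R) : `|ngon_x n t| <= circumradius R n + n%:R^-1.
Proof.
apply: le_trans (ler_normD _ _) _; rewrite !normrM lerD//.
  by rewrite gtr0_norm ?circumradius_gt0// ler_piMr ?cos_max// ltW// circumradius_gt0.
rewrite -[leRHS]mulr1; apply: ler_pM => //; first exact: norm_node_le.
exact: norm_ngon_dx_le1.
Qed.

Lemma norm_ngon_y_le (t : R) : `|ngon_y n t| <= circumradius R n + n%:R^-1.
Proof.
apply: le_trans (ler_normD _ _) _; rewrite !normrM lerD//.
  by rewrite gtr0_norm ?circumradius_gt0// ler_piMr ?sin_max// ltW// circumradius_gt0.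
rewrite -[leRHS]mulr1; apply: ler_pM => //; first exact: norm_node_le.
exact: norm_ngon_dy_le1.
Qed.

Lemma node_periodic (t : R) : node n (t + 1) = node n t + 1.
Proof. by have := nodeD n1 n t; rewrite -pmulrn divff ?lt0r_neq0. Qed.

Lemma ngon_velocity_periodic (u v : 'rV[R]_d) : periodic (ngon_velocity n u v) 1.
Proof.
move=> t; rewrite /ngon_velocity /ngon_dx /ngon_dy node_periodic.
have -> : 2 * pi * (node n t + 1) + pi / n%:R
  = 2 * pi * node n t + pi / n%:R + pi *+ 2 by rewrite mulr2n; ring.
by rewrite sinD2pi cosD2pi.
Qed.

Lemma ngon_W1infty (o u v : 'rV[R]_d) (a : R) :
  dotp u u = 1 -> dotp v v = 1 -> 0 <= a <= 1 ->
  W1infty_derivative (fun t => ngon n o u v (t - a))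
                     (fun t => ngon_velocity n u v (t - a)).
Proof.
move=> uu vv /andP[a0 a1].
have msub : measurable_fun [set: R] (fun t : R => t - a) by exact: measurable_funB.
pose r := circumradius R n; have r0 : 0 < r := circumradius_gt0 R n1.
have ni : n%:R^-1 <= 1 :> R by rewrite invf_le1// ler1n ltnW.
(* The points [c k] are corners of the shifted polygon, from [c 0 = a - 1] to [c (2 n) = a + 1]. As
   [0 <= a <= 1] they span [[0, 1]], and clamping them collapses the edges outside. *)
pose k0 (k : nat) : int := k%:Z - n%:Z.
pose c (k : nat) : R := a + (k0 k)%:~R / n%:R.
have cS k : c k.+1 = a + ((k0 k)%:~R + 1) / n%:R.
  by rewrite /c (_ : k0 k.+1 = k0 k + 1) ?intrD// /k0; lia.
apply: (@W1infty_derivative_of_pieces _ _ _ _ (enorm o + 2 * (r + 1) + 2)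
  (fun k => Num.max 0 (Num.min 1 (c k))) (2 * n)).
- by move=> t; rewrite addrAC ngon_periodic.
- by move=> t; rewrite addrAC ngon_velocity_periodic.
- move=> i; under eq_fun do rewrite ngon_coordE.
  apply: measurable_funD => //; apply: measurable_funD; apply: measurable_funM => //.
    exact: (measurableT_comp measurable_ngon_x msub).
  exact: (measurableT_comp measurable_ngon_y msub).
- move=> i; under eq_fun do rewrite ngon_velocity_coordE.
  apply: measurable_funD; apply: measurable_funM => //.
    exact: (measurableT_comp measurable_ngon_dx msub).
  exact: (measurableT_comp measurable_ngon_dy msub).
- move=> t i; rewrite ngon_coordE.
  have h1 := norm_comb2_le (ngon_x n (t - a)) (ngon_y n (t - a))
    (norm_coord_le1 i uu) (norm_coord_le1 i vv).
  have h2 := norm_ngon_x_le (t - a); have h3 := norm_ngon_y_le (t - a).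
  have h4 := ler_normD (o 0 i) (ngon_x n (t - a) * u 0 i + ngon_y n (t - a) * v 0 i).
  have h5 := norm_coord_le_enorm o i; rewrite -/r in h2 h3.
  lra.
- move=> t i; rewrite ngon_velocity_coordE.
  have h1 := norm_comb2_le (ngon_dx n (t - a)) (ngon_dy n (t - a))
    (norm_coord_le1 i uu) (norm_coord_le1 i vv).
  have h2 := norm_ngon_dx_le1 (t - a); have h3 := norm_ngon_dy_le1 (t - a).
  have h5 := enorm_ge0 o; lra.
- have -> : c 0%N = a - 1 by rewrite /c /k0 sub0r intrN -pmulrn mulNr divff ?lt0r_neq0.
  by rewrite minEle maxEle; case: ifP; case: ifP; lra.
- have -> : c (2 * n)%N = a + 1.
    rewrite /c /k0 intrB -!pmulrn natrM; field; exact: lt0r_neq0.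
  by rewrite minEle maxEle; case: ifP; case: ifP; lra.
- move=> k; have : c k <= c k.+1.
    by rewrite cS /c lerD2l ler_pM2r ?invr_gt0// lerDl.
  by move=> ck; rewrite !minEle !maxEle; do ![case: ifP]; lra.
move=> k i sk.
have [s1 s2] : c k <= Num.max 0 (Num.min 1 (c k)) /\
    Num.max 0 (Num.min 1 (c k.+1)) <= c k.+1.
  move: sk; rewrite !minEle !maxEle; do ![case: ifP]; lra.
pose s := 2 * pi * ((k0 k)%:~R / n%:R) : R.
pose dx : R := - sin (s + pi / n%:R); pose dy : R := cos (s + pi / n%:R).
pose e : R := dx * u 0 i + dy * v 0 i.
pose b : R := o 0 i + ((r * cos s - c k * dx) * u 0 i + (r * sin s - c k * dy) * v 0 i).
exists (fun t => b + t * e), (fun=> e); split.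
- by move=> t; exact: is_derive_affine.
- by move=> t; exact: cvg_cst.
- move=> t /andP[t1 t2]; rewrite ngon_coordE.
  have tI : (k0 k)%:~R / n%:R <= t - a <= ((k0 k)%:~R + 1) / n%:R.
    have h1 := le_trans s1 t1; have h2 := le_trans t2 s2.
    by rewrite cS in h2; rewrite /c in h1; apply/andP; split; lra.
  rewrite (ngon_xE n1 tI) (ngon_yE n1 tI) -/s -/r -/dx -/dy /b /e /c.
  by ring.
- move=> t /andP[t1 t2]; rewrite ngon_velocity_coordE /ngon_dx /ngon_dy.
  rewrite (node_eq n1 (k := k0 k)) //.
    by have := lt_le_trans t2 s2; have := le_lt_trans s1 t1; rewrite /c; lra.
  by have := lt_le_trans t2 s2; rewrite cS; lra.
Qed.

(** Three errors: the radius, the angle of [node n t] instead of [t], and the displacement along the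
    edge. The last two cost at most [1 / n] each. *)
Lemma ngon_x_close (t : R) :
  `|ngon_x n t - (2 * pi)^-1 * cos (2 * pi * t)|
  <= `|circumradius R n - (2 * pi)^-1| + 2 / n%:R.
Proof.
set r := circumradius R n; set q := (2 * pi)^-1.
have p0 : 0 < 2 * pi :> R by have := twopi_gt1 R; lra.
have q0 : 0 < q by rewrite invr_gt0.
have -> : ngon_x n t - q * cos (2 * pi * t) = (r - q) * cos (2 * pi * node n t)
  + (q * (cos (2 * pi * node n t) - cos (2 * pi * t)) + (t - node n t) * ngon_dx n t).
  by rewrite /ngon_x -/r; ring.
apply: le_trans (ler_normD _ _) _; apply: lerD.
  by rewrite normrM ler_piMr// cos_max.
rewrite (_ : 2 / n%:R = n%:R^-1 + n%:R^-1); last by ring.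
apply: le_trans (ler_normD _ _) _; apply: lerD.
  rewrite normrM gtr0_norm//.
  apply: (@le_trans _ _ (q * `|2 * pi * node n t - 2 * pi * t|)).
    by rewrite ler_pM2l// norm_cosB_le.
  rewrite -mulrBr normrM gtr0_norm// mulrA mulVf ?lt0r_neq0// mul1r distrC.
  exact: norm_node_le.
rewrite normrM -[leRHS]mulr1; apply: ler_pM => //; first exact: norm_node_le.
exact: norm_ngon_dx_le1.
Qed.

Lemma ngon_y_close (t : R) :
  `|ngon_y n t - (2 * pi)^-1 * sin (2 * pi * t)|
  <= `|circumradius R n - (2 * pi)^-1| + 2 / n%:R.
Proof.
set r := circumradius R n; set q := (2 * pi)^-1.
have p0 : 0 < 2 * pi :> R by have := twopi_gt1 R; lra.
have q0 : 0 < q by rewrite invr_gt0.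
have -> : ngon_y n t - q * sin (2 * pi * t) = (r - q) * sin (2 * pi * node n t)
  + (q * (sin (2 * pi * node n t) - sin (2 * pi * t)) + (t - node n t) * ngon_dy n t).
  by rewrite /ngon_y -/r; ring.
apply: le_trans (ler_normD _ _) _; apply: lerD.
  by rewrite normrM ler_piMr// sin_max.
rewrite (_ : 2 / n%:R = n%:R^-1 + n%:R^-1); last by ring.
apply: le_trans (ler_normD _ _) _; apply: lerD.
  rewrite normrM gtr0_norm//.
  apply: (@le_trans _ _ (q * `|2 * pi * node n t - 2 * pi * t|)).
    by rewrite ler_pM2l// norm_sinB_le.
  rewrite -mulrBr normrM gtr0_norm// mulrA mulVf ?lt0r_neq0// mul1r distrC.
  exact: norm_node_le.
rewrite normrM -[leRHS]mulr1; apply: ler_pM => //; first exact: norm_node_le.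
exact: norm_ngon_dy_le1.
Qed.

(** The direction of an edge is the tangent at the middle of its arc, which is at most [1 / (2 n)]
    away from [t]. *)
Lemma node_angle_close (t : R) :
  `|2 * pi * node n t + pi / n%:R - 2 * pi * t| <= pi / n%:R.
Proof.
have p0 := pi_gt0 R; have h1 := node_le n1 t.
have h2 : pi * (t - node n t) <= pi / n%:R.
  by rewrite ler_pM2l//; have := norm_node_le t; rewrite ger0_norm ?subr_ge0.
have h3 : 0 <= pi * (t - node n t) by rewrite mulr_ge0 ?subr_ge0// ltW.
by rewrite ler_norml; apply/andP; split; lra.
Qed.

Lemma ngon_dx_close (t : R) : `|ngon_dx n t - - sin (2 * pi * t)| <= pi / n%:R.
Proof.
rewrite /ngon_dx opprK addrC distrC.
exact: le_trans (norm_sinB_le _ _) (node_angle_close t).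
Qed.

Lemma ngon_dy_close (t : R) : `|ngon_dy n t - cos (2 * pi * t)| <= pi / n%:R.
Proof. exact: le_trans (norm_cosB_le _ _) (node_angle_close t). Qed.

End NgonRegularity.

(** * Convergence *)

Lemma norm_prodB_le (R : realType) (x y u w e1 e2 : R) :
  `|x - y| <= e1 -> `|u - w| <= e2 -> `|u| <= 1 -> `|y| <= 1 ->
  `|x * u - y * w| <= e1 + e2.
Proof.
move=> xy uw u1 y1; have -> : x * u - y * w = (x - y) * u + y * (u - w) by ring.
apply: le_trans (ler_normD _ _) _; rewrite !normrM lerD//.
  by apply: le_trans xy; rewrite ler_piMr.
by apply: le_trans uw; rewrite ler_piMl.
Qed.

Section NgonNearCircle.
Variables (R : realType) (d n : nat) (o u v c w z : 'rV[R]_d) (a b e : R).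
Hypotheses (n1 : (1 < n)%N) (uu : dotp u u = 1) (vv : dotp v v = 1).
Hypotheses (ab : `|a - b| <= e) (oc : forall i, `|o 0 i - c 0 i| <= e).
Hypotheses (uw : forall i, `|u 0 i - w 0 i| <= e).
Hypotheses (vz : forall i, `|v 0 i - z 0 i| <= e).
Hypotheses (re : `|circumradius R n - (2 * pi)^-1| <= e) (ne : n%:R^-1 <= e).

Let angle_close (t : R) : `|2 * pi * (t - a) - 2 * pi * (t - b)| <= 2 * pi * e.
Proof.
have p0 := pi_gt0 R.
have -> : 2 * pi * (t - a) - 2 * pi * (t - b) = 2 * pi * (b - a) by ring.
by rewrite normrM gtr0_norm ?mulr_gt0// ler_pM2l ?mulr_gt0// distrC.
Qed.

(** Of the [11 e], one comes from the center and five from each axis: radius [e], [2 / n <= 2 e],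
    phase [e], and [e] for the axis vector itself. *)
Lemma ngon_near_circle (t : R) :
  enorm (ngon n o u v (t - a) - circle c w z (t - b)) <= d%:R * (11 * e).
Proof.
apply: enorm_le_sum => i; rewrite mxE [X in _ + X]mxE ngon_coordE circle_coordE.
set q : R := (2 * pi)^-1; have p1 := twopi_gt1 R.
have q0 : 0 < q by rewrite invr_gt0; lra.
have q1 : q <= 1 by rewrite invf_le1 ?ltW//; lra.
have n2 : 2 / n%:R <= 2 * e by rewrite ler_pM2l.
have q_close (f : R -> R) : (forall x y, `|f x - f y| <= `|x - y|) ->
    `|q * f (2 * pi * (t - a)) - q * f (2 * pi * (t - b))| <= e.
  move=> fl; rewrite -mulrBr normrM gtr0_norm//.
  apply: (@le_trans _ _ (q * (2 * pi * e))).
    by rewrite ler_pM2l//; exact: le_trans (fl _ _) (angle_close t).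
  by rewrite mulrA mulVf ?mul1r// lt0r_neq0//; lra.
have qle (s : R) : `|s| <= 1 -> `|q * s| <= 1.
  move=> s1; rewrite normrM gtr0_norm// -[leRHS]mulr1; apply: ler_pM => //.
  exact: ltW.
have hx : `|ngon_x n (t - a) * u 0 i - q * cos (2 * pi * (t - b)) * w 0 i| <= 4 * e + e.
  apply: norm_prodB_le => //; [|exact: norm_coord_le1|exact/qle/cos_max].
  apply: le_trans (ler_distD (q * cos (2 * pi * (t - a))) _ _) _.
  have := ngon_x_close n1 (t - a); have := q_close _ (@norm_cosB_le R).
  by have := re; rewrite -/q; lra.
have hy : `|ngon_y n (t - a) * v 0 i - q * sin (2 * pi * (t - b)) * z 0 i| <= 4 * e + e.
  apply: norm_prodB_le => //; [|exact: norm_coord_le1|exact/qle/sin_max].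
  apply: le_trans (ler_distD (q * sin (2 * pi * (t - a))) _ _) _.
  have := ngon_y_close n1 (t - a); have := q_close _ (@norm_sinB_le R).
  by have := re; rewrite -/q; lra.
have h0 := oc i.
set X := ngon_x n _ * _ in hx *; set X' := q * cos _ * _ in hx.
set Y := ngon_y n _ * _ in hy *; set Y' := q * sin _ * _ in hy.
have -> : o 0 i + (X + Y) - (c 0 i + q * (cos (2 * pi * (t - b)) * w 0 i
    + sin (2 * pi * (t - b)) * z 0 i)) = (o 0 i - c 0 i) + ((X - X') + (Y - Y')).
  by rewrite /X' /Y'; ring.
have := ler_normD (o 0 i - c 0 i) (X - X' + (Y - Y')).
by have := ler_normD (X - X') (Y - Y'); lra.
Qed.

(** Each axis costs [pi e] for the direction of the edge, [2 pi e] for the phase and [e] for the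
    axis vector. *)
Lemma ngon_velocity_near_circle (t : R) :
  enorm (ngon_velocity n u v (t - a) - circle_velocity w z (t - b))
  <= d%:R * ((6 * pi + 2) * e).
Proof.
apply: enorm_le_sum => i.
rewrite mxE [X in _ + X]mxE ngon_velocity_coordE circle_velocity_coordE.
have p0 := pi_gt0 R; have n2 : pi / n%:R <= pi * e by rewrite ler_pM2l.
have hx : `|ngon_dx n (t - a) * u 0 i - - sin (2 * pi * (t - b)) * w 0 i|
    <= 3 * pi * e + e.
  apply: norm_prodB_le => //; [|exact: norm_coord_le1|by rewrite normrN sin_max].
  apply: le_trans (ler_distD (- sin (2 * pi * (t - a))) _ _) _.
  have := ngon_dx_close n1 (t - a).
  have := le_trans (norm_sinB_le (2 * pi * (t - a)) _) (angle_close t).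
  by rewrite -[X in X <= 2 * pi * e]normrN opprB addrC -[sin _ as X in _ + X]opprK; lra.
have hy : `|ngon_dy n (t - a) * v 0 i - cos (2 * pi * (t - b)) * z 0 i|
    <= 3 * pi * e + e.
  apply: norm_prodB_le => //; [|exact: norm_coord_le1|exact: cos_max].
  apply: le_trans (ler_distD (cos (2 * pi * (t - a))) _ _) _.
  have := ngon_dy_close n1 (t - a).
  have := le_trans (norm_cosB_le (2 * pi * (t - a)) _) (angle_close t).
  by lra.
rewrite opprD addrACA; apply: le_trans (ler_normD _ _) _; lra.
Qed.

End NgonNearCircle.

Lemma cvg_geq_id (g : nat -> nat) : (forall k, (k <= g k)%N) -> g @ \oo --> \oo.
Proof.
move=> gk A [N _ NA]; exists N => // k /= Nk.
by apply: NA => /=; exact: leq_trans (gk k).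
Qed.

Lemma cvg_invn (R : realType) : (fun n => n%:R^-1 : R) @ \oo --> (0 : R).
Proof.
rewrite -cvg_shiftS; exact: cvg_harmonic.
Qed.

(* By the mean value theorem, [n * sin (pi / n) = pi * cos x] with
   [0 <= x <= pi / n]. *)
Lemma cvg_circumradius (R : realType) :
  circumradius R @ \oo --> ((2 * pi)^-1 : R).
Proof.
have p0 := pi_gt0 R.
have lim : (fun n => n%:R * sin (pi / n%:R) : R) @ \oo --> (pi : R).
  apply/subr_cvg0.
  apply: (@squeeze_cvgr _ _ _ _ (fun n => - (pi * (pi * n%:R^-1)))
    (fun n => pi * (pi * n%:R^-1))).
  - near=> n; rewrite -ler_norml.
    have n0 : 0 < n%:R :> R by rewrite ltr0n; near: n; exists 1%N.
    have h0 : 0 <= pi / n%:R :> R by rewrite divr_ge0// ltW.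
    have [|x + sE] := @MVT_segment R sin cos 0 (pi / n%:R) h0.
      exact/continuous_subspaceT/continuous_sin.
    rewrite in_itv/= => /andP[x0 xn].
    move: sE; rewrite sin0 !subr0 => ->.
    rewrite (_ : _ - pi = pi * (cos x - cos 0)); last first.
      by rewrite cos0; field; exact: lt0r_neq0.
    rewrite normrM gtr0_norm// ler_pM2l//.
    by apply: le_trans (norm_cosB_le _ _) _; rewrite subr0 ger0_norm.
  - rewrite -oppr0; apply: cvgN; rewrite -(mulr0 pi) -[X in pi * X](mulr0 pi).
    by apply: cvgMr; apply: cvgMr; exact: cvg_invn.
  - rewrite -(mulr0 pi) -[X in pi * X](mulr0 pi).
    by apply: cvgMr; apply: cvgMr; exact: cvg_invn.
apply: cvgV; first by rewrite mulf_neq0// lt0r_neq0.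
exact: cvgMr.
Unshelve. all: by end_near. Qed.

Lemma cvg_bigsum (R : realType) (I : Type) (r : seq I) (s : I -> nat -> R)
    (l : I -> R) : (forall i, s i @ \oo --> l i) ->
  (fun k => \sum_(i <- r) s i k) @ \oo --> \sum_(i <- r) l i.
Proof.
move=> sl; elim: r => [|i r IH].
  by rewrite big_nil; under eq_fun do rewrite big_nil; exact: cvg_cst.
rewrite big_cons; under eq_fun do rewrite big_cons.
exact: cvgD.
Qed.

(** Bolzano-Weierstrass is applied to one index after the other; each extraction preserves the
    limits already obtained. *)
Lemma bounded_family_cvg_subseq (R : realType) (I : finType)
    (s : I -> nat -> R) (M : R) : (forall i k, `|s i k| <= M) ->
  exists (f : nat -> nat) (l : I -> R), (forall k, (f k < f k.+1)%N) /\
    forall i, (fun k => s i (f k)) @ \oo --> l i.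
Proof.
move=> sM; suff [f [l [fS fl]]] : exists (f : nat -> nat) (l : I -> R),
    (forall k, (f k < f k.+1)%N) /\
    forall i, i \in enum I -> (fun k => s i (f k)) @ \oo --> l i.
  by exists f, l; split => // i; apply: fl; rewrite mem_enum.
elim: (enum I) => [|i r [f [l [fS fl]]]]; first by exists id, (fun=> 0).
have bs : bounded_fun (fun k => s i (f k)).
  exists M; split; first exact: num_real.
  by move=> x Mx k _; apply: le_trans (sM i (f k)) (ltW Mx).
have [g /increasing_seqP gS /cvg_ex[y gy]] := bolzano_weierstrass bs.
have gid k : (k <= g k)%N.
  by elim: k => // k /leq_ltn_trans; apply; exact: gS.
have fmono j k : (j < k)%N -> (f j < f k)%N.
  elim: k => // k IH; rewrite ltnS leq_eqVlt => /orP[/eqP->//|/IH].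
  by move=> h; exact: ltn_trans (fS k).
exists (f \o g), (fun j => if j == i then y else l j); split.
  by move=> k; apply: fmono; exact: gS.
move=> j; rewrite in_cons; have [->//|ji /= jr] := eqVneq j i.
exact: (cvg_comp _ _ (cvg_geq_id gid) (fl j jr)).
Qed.

Lemma dotp_cvg (R : realType) (d : nat) (u v : nat -> 'rV[R]_d) (w z : 'rV[R]_d)
    (x : R) :
  (forall i, (fun k => u k 0 i) @ \oo --> w 0 i) ->
  (forall i, (fun k => v k 0 i) @ \oo --> z 0 i) ->
  (forall k, dotp (u k) (v k) = x) -> dotp w z = x.
Proof.
move=> uw vz uvx.
have h : (fun k => dotp (u k) (v k)) @ \oo --> dotp w z.
  by apply: cvg_bigsum => i; exact: cvgM.
rewrite (_ : (fun k => _) = cst x) in h; last exact/funext.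
by rewrite -(cvg_lim _ h)// lim_cst.
Qed.

(** The phase is absorbed by rotating the two axes in their plane. *)
Lemma circle_round (R : realType) (d : nat) (o u v : 'rV[R]_d) (a : R) :
  dotp u u = 1 -> dotp v v = 1 -> dotp u v = 0 ->
  round_circle (fun t => circle o u v (t - a)).
Proof.
move=> uu vv uv; set C := cos (2 * pi * a); set S := sin (2 * pi * a).
have CS : C ^+ 2 + S ^+ 2 = 1 by exact: cos2Dsin2.
exists o, (C *: u - S *: v), (S *: u + C *: v); split.
- rewrite !(dotpBl, dotpBr, dotpZl, dotpZr) (dotpC v u) uu vv uv.
  by rewrite -[RHS]CS; ring.
- rewrite !(dotpDl, dotpDr, dotpZl, dotpZr) (dotpC v u) uu vv uv.
  by rewrite -[RHS]CS; ring.
- rewrite !(dotpBl, dotpDr, dotpZl, dotpZr) (dotpC v u) uu vv uv.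
  by ring.
move=> t; rewrite /circle mulrBr cosB sinB -/C -/S.
by apply/rowP => i; rewrite !mxE; ring.
Qed.

Lemma Linfty_norm_ge0 (R : realType) (d : nat) (f : R -> 'rV[R]_d) :
  (0 <= Linfty_norm f)%E.
Proof. exact: Lnorm_ge0. Qed.

Theorem corollary6 (R : realType) (d : nat) (hd : (2 <= d)%N)
  (p : nat -> R -> 'rV[R]_d)
  (hp : forall n, (3 <= n)%N -> equilateral_polygons n (p n))
  (hbounded : exists M : R,
     forall n, (3 <= n)%N -> (Linfty_norm (p n) <= M%:E)%E)
  (hmin : forall n, (3 <= n)%N ->
     mobius_energy n (p n)
     = ereal_inf [set mobius_energy n q | q in @equilateral_polygons R d n]) :
  exists (nk : nat -> nat) (gamma : R -> 'rV[R]_d),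
    [/\ (3 <= nk 0)%N,
        forall k, (nk k < nk k.+1)%N,
        round_circle gamma
      & cvg_W1infty (fun k => p (nk k)) gamma].
Proof.
case: hbounded => M pM.
pose V := 'rV[R]_d.
have /choice[P PE] (k : nat) : exists w : R * V * V * V,
    let: (a, o, u, v) := w in
    [/\ 0 <= a <= 1, dotp u u = 1, dotp v v = 1, dotp u v = 0
      & forall t, p (k + 3)%N t = ngon (k + 3) o u v (t - a)].
  have k3 : (3 <= k + 3)%N by rewrite leq_addl.
  have [a [c [u [v [uu vv uv pE]]]]] :=
    @minimizer_ngon R d _ _ hd k3 (hp _ k3) (hmin _ k3).
  (* By periodicity the phase can be reduced modulo 1, which makes it bounded. *)
  exists (a - (Num.floor a)%:~R, c, u, v); split => //.
    by have := floor_itv a; rewrite intrD => /andP[? ?]; apply/andP; split; lra.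
  move=> t; rewrite pE -[RHS](periodic1_int (- Num.floor a)); last first.
    by apply: ngon_periodic; rewrite addn3.
  by rewrite intrN; congr (ngon _ _ _ _ _); ring.
pose a k := (P k).1.1.1. pose o k := (P k).1.1.2.
pose u k := (P k).1.2. pose v k := (P k).2.
have {PE} PE k : [/\ 0 <= a k <= 1, dotp (u k) (u k) = 1, dotp (v k) (v k) = 1,
    dotp (u k) (v k) = 0
    & forall t, p (k + 3)%N t = ngon (k + 3) (o k) (u k) (v k) (t - a k)].
  by have := PE k; rewrite /a /o /u /v; case: (P k) => [[[? ?] ?] ?].
have a01 k : 0 <= a k <= 1 by have [] := PE k.
have uu k : dotp (u k) (u k) = 1 by have [] := PE k.
have vv k : dotp (v k) (v k) = 1 by have [] := PE k.
have uv k : dotp (u k) (v k) = 0 by have [] := PE k.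
have pE k : p (k + 3)%N = (fun t => ngon (k + 3) (o k) (u k) (v k) (t - a k)).
  by apply/funext; have [] := PE k.
have k1 k : (1 < k + 3)%N by rewrite addn3.
have [r rM] : exists r, forall n, `|circumradius R n| <= r.
  have [r [_ rM]] := cvg_seq_bounded (cvgP _ (cvg_circumradius (R := R))).
  by exists (r + 1) => n; apply: (rM (r + 1)) => //; rewrite ltrDl.
(* Some point of the polygon satisfies the bound [M], and the coordinates of the polygon relative to
   its center are at most [2 (r + 1)]. *)
have oM i k : `|o k 0 i| <= M + 2 * (r + 1).
  have [t] := Linfty_norm_witness (pM (k + 3)%N (leq_addl _ _)).
  move=> /(le_trans (norm_coord_le_enorm _ i)); rewrite pE ngon_coordE => h.
  have nle : (k + 3)%:R^-1 <= 1 :> R by rewrite invf_le1 ?ler1n ?ltr0n ?addn3.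
  have r0 := rM (k + 3)%N.
  have r1 : circumradius R (k + 3) <= r by apply: le_trans r0; exact: ler_norm.
  have h1 := norm_ngon_x_le (k1 k) (t - a k).
  have h2 := norm_ngon_y_le (k1 k) (t - a k).
  have h3 := norm_comb2_le (ngon_x (k + 3) (t - a k)) (ngon_y (k + 3) (t - a k))
    (norm_coord_le1 i (uu k)) (norm_coord_le1 i (vv k)).
  set X := ngon_x _ _ * _ + _ in h h3; have := ler_normB (o k 0 i + X) X.
  by rewrite addrK; lra.
(* One index set for all the real parameters, so that a single extraction makes them all converge:
   the phase, then the coordinates of the center and of the two axes. *)
pose I : finType := (unit + ('I_d + ('I_d + 'I_d)))%type.
pose s (i : I) k : R := match i with
  | inl _ => a k | inr (inl j) => o k 0 j
  | inr (inr (inl j)) => u k 0 j | inr (inr (inr j)) => v k 0 j end.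
have sM i k : `|s i k| <= `|M + 2 * (r + 1)| + 1.
  have B0 := normr_ge0 (M + 2 * (r + 1)); have BM := ler_norm (M + 2 * (r + 1)).
  case: i => [_|[j|[j|j]]] /=.
  - by have /andP[? ?] := a01 k; rewrite ger0_norm//; lra.
  - by have := oM j k; lra.
  - by have := norm_coord_le1 j (uu k); lra.
  - by have := norm_coord_le1 j (vv k); lra.
have [f [l [fS fl]]] := bounded_family_cvg_subseq sM.
have fid k : (k <= f k)%N by elim: k => // k /leq_ltn_trans; apply; exact: fS.
pose b := l (inl tt). pose c : V := \row_j l (inr (inl j)).
pose w : V := \row_j l (inr (inr (inl j))).
pose z : V := \row_j l (inr (inr (inr j))).
have wE j : w 0 j = l (inr (inr (inl j))) by rewrite mxE.
have zE j : z 0 j = l (inr (inr (inr j))) by rewrite mxE.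
have cE j : c 0 j = l (inr (inl j)) by rewrite mxE.
have uw j : (fun k => u (f k) 0 j) @ \oo --> w 0 j by rewrite wE; exact: fl.
have vz j : (fun k => v (f k) 0 j) @ \oo --> z 0 j by rewrite zE; exact: fl.
have ww : dotp w w = 1 by apply: (dotp_cvg uw uw) => k; exact: uu.
have zz : dotp z z = 1 by apply: (dotp_cvg vz vz) => k; exact: vv.
have wz : dotp w z = 0 by apply: (dotp_cvg uw vz) => k; exact: uv.
exists (fun k => f k + 3)%N, (fun t => circle c w z (t - b)); split.
- by rewrite leq_addl.
- by move=> k; rewrite ltn_add2r.
- exact: circle_round.
exists (fun k t => ngon_velocity (f k + 3) (u (f k)) (v (f k)) (t - a (f k))),
  (fun t => circle_velocity w z (t - b)); split.
- by move=> k; rewrite pE; exact: ngon_W1infty.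
- exact: circle_W1infty.
(* A single null sequence that dominates every error in the two estimates of the distance to the
   circle. *)
pose e k : R := \sum_i `|s i (f k) - l i| + `|circumradius R (f k + 3) - (2 * pi)^-1|
  + (f k + 3)%:R^-1.
have f3 : (fun k => f k + 3)%N @ \oo --> \oo.
  by apply: cvg_geq_id => k; exact: leq_trans (fid k) (leq_addr _ _).
have e0 : e @ \oo --> (0 : R).
  rewrite -[X in _ --> X](addr0 (0 : R)) -[X in _ --> X + _](addr0 (0 : R)).
  apply: cvgD; last exact: (cvg_comp _ _ f3 (cvg_invn (R := R))).
  apply: cvgD.
    rewrite [X in _ --> X](_ : 0 = \sum_(i : I) 0); last by rewrite big1.
    by apply: cvg_bigsum => i; apply/norm_cvg0P/subr_cvg0; exact: fl.
  by apply/norm_cvg0P/subr_cvg0; exact: (cvg_comp _ _ f3 (cvg_circumradius (R := R))).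
have se i k : `|s i (f k) - l i| <= e k.
  rewrite /e (bigD1 i)//= -!addrA lerDl.
  by rewrite !addr_ge0// ?sumr_ge0// invr_ge0.
have re k : `|circumradius R (f k + 3) - (2 * pi)^-1| <= e k.
  by rewrite /e addrAC lerDr addr_ge0// ?sumr_ge0// invr_ge0.
have ne k : (f k + 3)%:R^-1 <= e k by rewrite /e lerDr addr_ge0// sumr_ge0.
pose K : R := d%:R * 11 + d%:R * (6 * pi + 2).
apply: (@squeeze_cvge _ _ _ _ (cst 0%E) _ (fun k => (K * e k)%:E)).
- apply: nearW => k; rewrite adde_ge0 ?Linfty_norm_ge0//= /K mulrDl EFinD.
  apply: leeD; apply: Linfty_norm_le => t; rewrite -mulrA ?pE.
    apply: ngon_near_circle => // [|i|i|i]; rewrite ?cE ?wE ?zE.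
    - exact: (se (inl tt)).
    - exact: (se (inr (inl i))).
    - exact: (se (inr (inr (inl i)))).
    - exact: (se (inr (inr (inr i)))).
  apply: ngon_velocity_near_circle => // [|i|i]; rewrite ?wE ?zE.
  - exact: (se (inl tt)).
  - exact: (se (inr (inr (inl i)))).
  - exact: (se (inr (inr (inr i)))).
- exact: cvg_cst.
- apply: cvg_EFin; first by apply: nearW.
  by rewrite -[X in _ --> X](mulr0 K); exact: cvgMr.
Qed.
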